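(* There exists a universal constant $c>0$ with the following property. Let $H$ be a limit circle Hamburger Hamiltonian. Let $(f_n)_{n=0}^\infty$ and $(g_n)_{n=0}^\infty$ be two nondecreasing and bounded sequences of positive numbers such that $$\det\Omega(x_m,x_n)^\nu\ \le\ K\,(f_n-f_m)^\gamma(g_n-g_m)^\delta,\qquad m<n,$$ where $\nu,K,\gamma,\delta>0$ and $\gamma+\delta=1$. Let $f_\infty:=\lim_{n\to\infty}f_n$ and $g_\infty:=\lim_{n\to\infty}g_n$. Then $$\log|w_{H,22}(ir)|\ \le\ c\,\frac K\nu\,r^{2\nu}(f_\infty-f_0)^\gamma(g_\infty-g_0)^\delta$$ for all sufficiently large $r$. The constant $c$ is independent of $H,(f_n),(g_n),K,\nu,\gamma,\delta$.
   Context: Limit circle Hamburger Hamiltonian: let $(l_j)_{j=1}^\infty$ be positive numbers (''lengths'') with $L:=\sum_{j=1}^\infty l_j<\infty$, and $(\phi_j)_{j=1}^\infty$ real numbers (''angles'') with $\phi_{j+1}-\phi_j\notin\pi\mathbb{Z}$ for all $j$. Put $x_0:=0$, $x_n:=\sum_{j=1}^n l_j$, $\xi_\phi:=(\cos\phi,\sin\phi)^\top$, and $H(t):=\xi_{\phi_j}\xi_{\phi_j}^\top$ for $x_{j-1}\le t<x_j$, $j\in\mathbb{N}$; this defines $H$ on $(0,L)$. Monodromy matrix: with $J=\begin{pmatrix}0&-1\\1&0\end{pmatrix}$, for $z\in\mathbb{C}$ let $W_H(t;z)$ be the solution of $\frac{d}{dt}W_H(t;z)J=zW_H(t;z)H(t)$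 for a.e. $t\in(0,L)$, $W_H(0;z)=I$. It exists up to $t=L$, and $W_H(z):=W_H(L;z)=(w_{H,ij}(z))_{i,j=1}^2$. $\Omega(s,t):=\int_s^t H(x)\,dx$. The indices $m,n$ range over integers $0\le m<n$. *)

(* Defs.v *)
From HB Require Import structures.
From mathcomp Require Export all_boot all_order all_algebra.
From mathcomp.real_closed Require Export complex.
From mathcomp Require Export all_classical all_reals all_analysis.

Set Implicit Arguments.
Unset Strict Implicit.
Unset Printing Implicit Defensive.

Import Order.TTheory GRing.Theory Num.Theory.
Import numFieldNormedType.Exports.

Local Open Scope classical_set_scope.
Local Open Scope ring_scope.
Local Open Scope complex_scope.

(* Lengths and angles of a limit circle Hamburger Hamiltonian, numbered from 0:
   [len j] and [ang j] are the usual l_(j+1) and phi_(j+1). *)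
Record hamburger (R : realType) := Hamburger {
  len : nat -> R ;
  ang : nat -> R ;
  len_gt0 : forall j, 0 < len j ;
  len_summable : cvgn (series len) ;
  ang_sep : forall (j : nat) (k : int), ang j.+1 - ang j != k%:~R * pi
}.

Definition total_length (R : realType) (h : hamburger R) : R :=
  limn (series (len h)).

Definition node (R : realType) (h : hamburger R) (n : nat) : R :=
  \sum_(0 <= j < n) len h j.

Definition xi (R : realType) (phi : R) : 'cV[R]_2 :=
  \col_(i < 2) if i == 0 then cos phi else sin phi.

(* For t in [0, L[ the index picked by [xget] is the only one in the set;
   outside [0, L[ the set is empty and the value is irrelevant. *)
Definition hamiltonian (R : realType) (h : hamburger R) (t : R) : 'M[R]_2 :=
  let j := xget 0%N [set j | node h j <= t < node h j.+1] in
  xi (ang h j) *m (xi (ang h j))^T.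

Definition Omega (R : realType) (H : R -> 'M[R]_2) (s t : R) : 'M[R]_2 :=
  \matrix_(i, j) \int[lebesgue_measure]_(x in `[s, t]) H x i j.

Definition symplJ (K : nzRingType) : 'M[K]_2 := delta_mx 1 0 - delta_mx 0 1.

Definition abs_continuous (R : realType) (a b : R) (f : R -> R) : Prop :=
  forall e : R, 0 < e -> exists2 d : R, 0 < d &
    forall (n : nat) (u v : 'I_n -> R),
      (forall i, a <= u i /\ u i <= v i /\ v i <= b) ->
      trivIset setT (fun i => `]u i, v i[%classic) ->
      \sum_(i < n) (v i - u i) < d ->
      \sum_(i < n) `|f (v i) - f (u i)| < e.

(* Absolute continuity and differentiation of complex-valued functions of a
   real variable are taken on real and imaginary parts. *)
Definition abs_continuousC (R : realType) (a b : R) (f : R -> R[i]) : Prop :=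
  abs_continuous a b (fun t => complex.Re (f t)) /\
  abs_continuous a b (fun t => complex.Im (f t)).

Definition is_deriveC (R : realType) (f : R -> R[i]) (t : R) (d : R[i]) : Prop :=
  is_derive t 1 (fun s => complex.Re (f s)) (complex.Re d) /\
  is_derive t 1 (fun s => complex.Im (f s)) (complex.Im d).

(* W is the solution on [0, L] of W' J = z W H almost everywhere, W(0) = I;
   as usual for equations holding almost everywhere, solutions are absolutely
   continuous (here up to the right endpoint, so that W(L) is meaningful). *)
Definition is_fundamental_solution (R : realType) (H : R -> 'M[R]_2) (L : R)
    (z : R[i]) (W : R -> 'M[R[i]]_2) : Prop :=
  [/\ W 0 = 1%:M,
      forall i j, abs_continuousC 0 L (fun t => W t i j) &
      {ae @lebesgue_measure R, forall t, t \in `]0, L[ -> forall i j,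
        is_deriveC (fun s => (W s *m symplJ R[i]) i j) t
          ((z *: (W t *m map_mx (real_complex R) (H t))) i j)}].

(* Main.v *)
Require Import Defs.
From mathcomp Require Import sesquilinear spectral measurable_realfun.
From mathcomp Require Import ring lra zify.

Set Implicit Arguments.
Unset Strict Implicit.
Unset Printing Implicit Defensive.

Import Order.TTheory GRing.Theory Num.Theory.
Import numFieldNormedType.Exports.
Local Open Scope ring_scope.
Local Open Scope complex_scope.

(** The entry [w_22] at a node is a determinant.  On each piece of the Hamiltonian
    the differential equation integrates to an explicit transfer step
    ([fundamental_solution_node]; this uses that an absolutely continuous function
    whose derivative is almost everywhere a constant is affine,
    [abs_continuous_derive_cst]), and the resulting recursion is solved by
    [w_22 (x_n; z) = det (1 + z G)] ([det_green]), where [G] is the real symmetric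
    Green matrix with entries
    [sqrt (l_j l_k) sin phi_min(j,k) cos phi_max(j,k)].  Hence
    [|w_22 (x_n; ir)|^2] is the product of the [1 + r^2 mu^2] over the eigenvalues
    [mu] of [G], and the theorem is a statement on how many eigenvalues are large.

    Partition the indices into [N] consecutive blocks with
    [det Omega <= k^2 / 4] each.  The entries of [G] outside the diagonal blocks
    are products [b_j a_k], and in a diagonal block one may subtract a multiple of
    the rank one matrix [a a^T] so that the Hilbert-Schmidt norm becomes at most
    [sqrt (2 det Omega) < k].  Thus [G] has norm less than [k] on a subspace of
    codimension at most [2 N], and at most [2 N] eigenvalues satisfy [|mu| >= k]
    ([card_green_eig_ge]).  A greedy choice of the blocks ([greedy_blocks]) together
    with the superadditivity of [(f_n - f_m)^gamma (g_n - g_m)^delta] gives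
    [2 N <= 2 + 8 E k^(-2 nu)] when [nu <= 1/2], with
    [E = K (f_oo - f_0)^gamma (g_oo - g_0)^delta] ([card_green_eig_le]).

    Ordering the [|mu|] decreasingly turns the count into the upper bound
    [(8 E / (j - 2))^(1 / (2 nu))] for the [j]-th of them, [j > 2], and summing
    logarithms yields
    [ln |w_22 (x_n; ir)| <= ln (1 + (r L)^2) + 20 (E / nu) r^(2 nu)] uniformly in
    [n] ([ln_det_green_le]); the factor [1 / nu] comes from
    [ln (1 + y^(1/nu)) <= (1 / (2 nu)) ln (1 + y^2)].  Letting [n] tend to infinity
    gives the estimate at [L], and the logarithmic term is absorbed for large [r]
    since [E > 0].  When [nu > 1/2], the same bound with exponent [1/2] and
    [x_n - x_m] on the right-hand side shows that [ln |w_22 (ir)|] is [O(r)], which is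
    negligible against [r^(2 nu)]. *)

(** * Counting eigenvalues of a normal matrix *)

Lemma det_1_add_col_row (K : comNzRingType) (n : nat) (u : 'cV[K]_n)
    (v : 'rV[K]_n) : \det (1%:M + u *m v) = 1 + (v *m u) 0 0.
Proof.
have E : block_mx (1%:M + u *m v) u 0 (1%:M : 'M[K]_1) *m
    block_mx 1%:M 0 (- v) 1%:M =
  block_mx 1%:M 0 (- v) 1%:M *m block_mx 1%:M u 0 (1%:M + v *m u).
  rewrite !mulmx_block !(mulmx0, mul0mx, mul1mx, mulmx1, addr0, add0r).
  by rewrite mulmxN mulNmx addrK [- _ + (_ + _)]addrCA addNr addr0.
have := congr1 determinant E.
rewrite !det_mulmx !det_ublock !det_lblock !det1 !mulr1 !mul1r => ->.
by rewrite det_mx11 !mxE eqxx.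
Qed.

(** Squared Euclidean norm of a complex row vector. *)
Definition normsq (C : numClosedFieldType) (n : nat) (x : 'rV[C]_n) : C :=
  \sum_j `|x 0 j| ^+ 2.

Section Spectrum.
Local Open Scope sesquilinear_scope.
Variable C : numClosedFieldType.

Lemma normsqE (n : nat) (x : 'rV[C]_n) : normsq x = (x *m x ^t*) 0 0.
Proof. by rewrite mxE; apply: eq_bigr => j _; rewrite !mxE normCK. Qed.

Lemma normsq_unitary (n : nat) (P : 'M[C]_n) (x : 'rV[C]_n) :
  P \is unitarymx -> normsq (x *m P) = normsq x.
Proof.
by move=> uP; rewrite !normsqE trmx_mul map_mxM mulmxA mulmxtVK.
Qed.

Lemma normsq_gt0 (n : nat) (x : 'rV[C]_n) : x != 0 -> 0 < normsq x.
Proof.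
move=> x0; have [j xj] : exists j, x 0 j != 0.
  apply/existsP; rewrite -negb_forall; apply: contra x0 => /forallP xj.
  by apply/eqP/rowP => j; rewrite mxE; exact/eqP.
rewrite /normsq (bigD1 j)//= ltr_pwDl ?exprn_gt0 ?normr_gt0//.
by apply: sumr_ge0 => i _; rewrite exprn_ge0.
Qed.

(** Counting principle: if the normal matrix [A] acts with norm less than [k]
    on a subspace of codimension at most [m], then at most [m] of its
    eigenvalues are at least [k] in modulus, as the span of the corresponding
    eigenvectors meets that subspace trivially. *)
Lemma card_large_eigenvalues (n m : nat) (A : 'M[C]_n) (X : 'M[C]_(n, m))
    (k : C) :
  A \is normalmx -> 0 <= k ->
  (forall x : 'rV_n, x *m X = 0 -> x != 0 ->
     normsq (x *m A) < k ^+ 2 * normsq x) ->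
  (#|[set i | (k <= `|spectral_diag A 0 i|)%R]| <= m)%N.
Proof.
move=> nA k0 small; rewrite leqNgt; apply/negP => ltm.
set S := [set i | _] in ltm.
have uP := spectral_unitarymx A; set P := spectralmx A in uP.
pose Sel : 'M[C]_(#|S|, n) := rowsub enum_val 1%:M.
have rk : kermx (Sel *m P *m X) != 0.
  rewrite -mxrank_eq0 mxrank_ker -lt0n subn_gt0.
  exact: leq_ltn_trans (rank_leq_col _) ltm.
have [i vi] : exists i, row i (kermx (Sel *m P *m X)) != 0.
  apply/existsP; rewrite -negb_forall; apply: contra rk => /forallP r0.
  by apply/eqP/row_matrixP => i; rewrite row0; exact/eqP.
set v := row i _ in vi.
have vX : v *m Sel *m P *m X = 0.
  by rewrite -2!mulmxA (mulmxA Sel) -row_mul mulmx_ker row0.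
have [y yDef] : exists y, y = v *m Sel by exists (v *m Sel).
have yE a : y 0 (enum_val a) = v 0 a.
  rewrite yDef mxE (bigD1 a)//= big1 ?addr0 => [|b ba]; rewrite !mxE ?eqxx ?mulr1//.
  by rewrite (inj_eq enum_val_inj) (negbTE ba) mulr0.
have yS j : j \notin S -> y 0 j = 0.
  move=> jS; rewrite yDef mxE big1 => // a _; rewrite !mxE.
  case: eqP => [E|_]; last by rewrite mulr0.
  by move: jS; rewrite -E enum_valP.
have y0 : y *m P != 0.
  apply: contra vi => /eqP yP0; apply/eqP/rowP => a.
  have yz : y = 0 by rewrite -[y](mulmxK (spectral_unit A)) -/P yP0 mul0mx.
  by rewrite -yE yz !mxE.
have /negP[] : ~~ (normsq (y *m P *m A) < k ^+ 2 * normsq (y *m P)).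
  rewrite {1}(orthomx_spectralP nA) -/P !mulmxA mulmxK ?spectral_unit//.
  rewrite !(normsq_unitary _ uP) real_ltNge ?negbK; last 2 first.
  - by rewrite ger0_real// sumr_ge0// => j _; rewrite exprn_ge0.
  - by rewrite ger0_real// mulr_ge0 ?exprn_ge0// sumr_ge0// => j _; rewrite exprn_ge0.
  rewrite mulr_sumr; apply: ler_sum => j _.
  rewrite mul_mx_diag mxE normrM exprMn mulrC.
  have [jS|/yS ->] := boolP (j \in S); last by rewrite normr0 expr0n !mul0r.
  rewrite ler_wpM2l ?exprn_ge0//; rewrite inE in jS.
  by rewrite lerXn2r ?nnegrE.
by apply: small; rewrite // yDef.
Qed.

Lemma det_1_scale_spectral (n : nat) (A : 'M[C]_n) (z : C) : A \is normalmx ->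
  \det (1%:M + z *: A) = \prod_i (1 + z * spectral_diag A 0 i).
Proof.
move=> nA; have Pu := spectral_unit A; set P := spectralmx A in Pu.
have -> : 1%:M + z *: A =
    invmx P *m diag_mx (\row_i (1 + z * spectral_diag A 0 i)) *m P.
  have -> : diag_mx (\row_i (1 + z * spectral_diag A 0 i)) =
     1%:M + z *: diag_mx (spectral_diag A).
    apply/matrixP => i j; rewrite !mxE.
    by case: eqP => [->|_]; rewrite ?mulr1n ?mulr0n ?mulr0 ?addr0.
  rewrite mulmxDr mulmxDl mulmx1 mulVmx//; congr (_ + _).
  by rewrite {1}(orthomx_spectralP nA) -/P -scalemxAr -scalemxAl.
rewrite !det_mulmx mulrAC -det_mulmx mulVmx// det1 mul1r det_diag.
by apply: eq_bigr => i _; rewrite mxE.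
Qed.

End Spectrum.

(** * Green matrices *)

(** The symmetric Green (single-pair) matrix with entries
    [b_min(j,k) * a_max(j,k)]. *)
Definition green (K : nzRingType) (a b : nat -> K) (n : nat) : 'M[K]_n :=
  \matrix_(j < n, k < n) (b (minn j k) * a (maxn j k)).

(** The recursion is that of one row [(w0, w1)] of the fundamental solution at
    the nodes, [a] and [b] being the weighted components of the directions.
    The quantities [y j = w0 j * a j + w1 j * b j] solve a unitriangular system
    [M y = b], and the Green perturbation of [M] has rank one:
    [1 + z G = M (1 + y v)] with [v = z a^T]. *)
Lemma det_green (K : comNzRingType) (a b w0 w1 : nat -> K) (z : K) (n : nat) :
  w0 0%N = 0 -> w1 0%N = 1 ->
  (forall j, w0 j.+1 = w0 j - z * b j * (w0 j * a j + w1 j * b j)) ->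
  (forall j, w1 j.+1 = w1 j + z * a j * (w0 j * a j + w1 j * b j)) ->
  w1 n = \det (1%:M + z *: green a b n).
Proof.
move=> w00 w10 w0S w1S.
pose y j := w0 j * a j + w1 j * b j.
have w0E m : w0 m = - z * \sum_(k < m) b k * y k.
  elim: m => [|m IH]; first by rewrite big_ord0 mulr0.
  by rewrite w0S -/(y m) IH big_ord_recr/=; ring.
have w1E m : w1 m = 1 + z * \sum_(k < m) a k * y k.
  elim: m => [|m IH]; first by rewrite big_ord0 mulr0 addr0.
  by rewrite w1S -/(y m) IH big_ord_recr/=; ring.
pose M : 'M[K]_n := \matrix_(j, k)
  ((j == k)%:R - z * (b j * a k - a j * b k) *+ (k < j)%N).
pose Y : 'cV[K]_n := \col_j y j.
pose s : 'cV[K]_n := \col_j b j.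
pose v : 'rV[K]_n := \row_k (z * a k).
have MY : M *m Y = s.
  apply/matrixP => j o; rewrite !mxE.
  under eq_bigr do rewrite !mxE mulrBl.
  rewrite sumrB (bigD1 j)//= eqxx mul1r [X in _ + X - _]big1 ?addr0; last first.
    by move=> k kj; rewrite eq_sym (negbTE kj) mul0r.
  rewrite (eq_bigr (fun k : 'I_n => if (k < j)%N then
     z * (b j * a k - a j * b k) * y k else 0)); last first.
    by move=> k _; case: ifP; rewrite ?mulr0n ?mul0r.
  rewrite -big_mkcond/= -(big_ord_widen _ (fun k =>
     z * (b j * a k - a j * b k) * y k)) ?(ltnW (ltn_ord j))//.
  have -> : \sum_(k < j) z * (b j * a k - a j * b k) * y k =
      z * b j * (\sum_(k < j) a k * y k) - z * a j * (\sum_(k < j) b k * y k).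
    by rewrite !mulr_sumr -sumrB; apply: eq_bigr => k _; ring.
  by rewrite {1}/y w0E w1E; ring.
have detM : \det M = 1.
  rewrite det_trig; last first.
    apply/is_trig_mxP => j k jk; rewrite !mxE.
    by rewrite [(k < j)%N]ltnNge ltnW// mulr0n subr0 -val_eqE/= ltn_eqF.
  by rewrite big1// => j _; rewrite !mxE eqxx ltnn mulr0n subr0.
have -> : 1%:M + z *: green a b n = M *m (1%:M + Y *m v).
  rewrite mulmxDr mulmx1 mulmxA MY; apply/matrixP => j k.
  rewrite !mxE big_ord1 !mxE.
  rewrite /minn /maxn; case: (ltngtP j k) => jk; rewrite ?mulr1n ?mulr0n.
  - by ring.
  - by ring.
  - by rewrite (val_inj jk); ring.
rewrite det_mulmx detM mul1r det_1_add_col_row w1E !mxE mulr_sumr.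
by congr (_ + _); apply: eq_bigr => k _; rewrite !mxE mulrA.
Qed.

(** Cauchy-Schwarz, from Lagrange's identity. *)
Lemma sqr_sum_le (F : numDomainType) (I : finType) (P : pred I) (p q : I -> F) :
  (forall i, p i \is Num.real) -> (forall i, q i \is Num.real) ->
  (\sum_(i | P i) p i * q i) ^+ 2 <=
  (\sum_(i | P i) p i ^+ 2) * (\sum_(i | P i) q i ^+ 2).
Proof.
move=> rp rq; rewrite -subr_ge0.
have : 0 <= \sum_(i | P i) \sum_(j | P j) (p i * q j - p j * q i) ^+ 2.
  apply: sumr_ge0 => i _; apply: sumr_ge0 => j _.
  by rewrite real_exprn_even_ge0// realB ?realM.
suff -> : \sum_(i | P i) \sum_(j | P j) (p i * q j - p j * q i) ^+ 2 =
   ((\sum_(i | P i) p i ^+ 2) * (\sum_(i | P i) q i ^+ 2) -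
   (\sum_(i | P i) p i * q i) ^+ 2) *+ 2 by rewrite pmulrn_lge0.
transitivity (\sum_(i | P i) \sum_(j | P j)
   ((p i ^+ 2 * q j ^+ 2 + q i ^+ 2 * p j ^+ 2) - (p i * q i * (p j * q j)) *+ 2)).
  by apply: eq_bigr => i _; apply: eq_bigr => j _; ring.
under eq_bigr do rewrite sumrB big_split/= sumrMnl -!mulr_sumr.
by rewrite sumrB big_split/= sumrMnl -!mulr_suml; ring.
Qed.

Lemma sqr_norm_sum_le (C : numDomainType) (I : finType) (P : pred I)
    (p q : I -> C) :
  `|\sum_(i | P i) p i * q i| ^+ 2 <=
  (\sum_(i | P i) `|p i| ^+ 2) * (\sum_(i | P i) `|q i| ^+ 2).
Proof.
apply: le_trans (sqr_sum_le _ _ _); last 2 first.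
- by move=> i; exact: normr_real.
- by move=> i; exact: normr_real.
rewrite lerXn2r ?nnegrE ?sumr_ge0//.
by apply: le_trans (ler_norm_sum _ _ _) _; apply: ler_sum => j _; rewrite normrM.
Qed.

Lemma normsq_mulmx_le (C : numClosedFieldType) (n : nat) (A : 'M[C]_n)
    (x : 'rV[C]_n) :
  normsq (x *m A) <= normsq x * \sum_k \sum_j `|A j k| ^+ 2.
Proof.
rewrite /normsq mulr_sumr; apply: ler_sum => k _; rewrite mxE.
exact: sqr_norm_sum_le.
Qed.

(** Gram determinant of the vectors [a] and [b] restricted to the indices
    [j < n] satisfying [P]. *)
Definition gram (K : nzRingType) (a b : nat -> K) (n : nat) (P : pred nat) : K :=
  (\sum_(j < n | P j) a j ^+ 2) * (\sum_(j < n | P j) b j ^+ 2) -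
  (\sum_(j < n | P j) a j * b j) ^+ 2.

(** Subtracting the multiple [al] of [a] that makes [b] orthogonal to [a] keeps
    the Gram determinant, which becomes a product of two squared norms; it then
    controls the Hilbert-Schmidt norm of the Green matrix of the new pair.  When
    [a = 0] the quotient defining [al] is 0 and both sides vanish. *)
Lemma sheared_green_hs_le (F : realFieldType) (a b : nat -> F) (n : nat)
    (P : pred nat) (al : F) :
  al = (\sum_(j < n | P j) a j * b j) / (\sum_(j < n | P j) a j ^+ 2) ->
  \sum_(j < n | P j) \sum_(k < n | P k)
    ((b (minn j k) - al * a (minn j k)) * a (maxn j k)) ^+ 2 <=
  2 * gram a b n P.
Proof.
set u := \sum_(j < n | P j) a j ^+ 2.
set w := \sum_(j < n | P j) a j * b j => alE.
set v := \sum_(j < n | P j) b j ^+ 2.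
pose b' j := b j - al * a j.
apply: (@le_trans _ _ (2 * (u * \sum_(j < n | P j) b' j ^+ 2))).
  have -> : 2 * (u * \sum_(j < n | P j) b' j ^+ 2) =
      \sum_(j < n | P j) \sum_(k < n | P k)
        (b' j ^+ 2 * a k ^+ 2 + a j ^+ 2 * b' k ^+ 2).
    rewrite [RHS](eq_bigr (fun j : 'I_n => b' j ^+ 2 * u +
        a j ^+ 2 * \sum_(k < n | P k) b' k ^+ 2)); last first.
      by move=> j _; rewrite big_split/= -!mulr_sumr.
    by rewrite big_split/= -!mulr_suml -/u; ring.
  apply: ler_sum => j _; apply: ler_sum => k _; rewrite -/(b' _) exprMn.
  rewrite /minn /maxn; case: ifP => _.
    by rewrite lerDl mulr_ge0 ?sqr_ge0.
  by rewrite [_ * a j ^+ 2]mulrC lerDr mulr_ge0 ?sqr_ge0.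
rewrite ler_pM2l ?ltr0n//.
have -> : \sum_(j < n | P j) b' j ^+ 2 = v - 2 * al * w + al ^+ 2 * u.
  transitivity (\sum_(j < n | P j)
    (b j ^+ 2 - 2 * al * (a j * b j) + al ^+ 2 * a j ^+ 2)).
    by apply: eq_bigr => j _; rewrite /b'; ring.
  by rewrite big_split/= sumrB -!mulr_sumr.
rewrite /gram -/u -/w -/v.
have [u0|u0] := eqVneq u 0; last first.
  by rewrite le_eqVlt; apply/orP; left; apply/eqP; rewrite alE; field.
suff -> : w = 0 by rewrite u0; lra.
rewrite /w big1// => j Pj; have /eqP : u = 0 by [].
rewrite psumr_eq0 => [/allP/(_ j)|i _]; last exact: sqr_ge0.
by rewrite mem_index_enum Pj/= sqrf_eq0 => /(_ isT)/eqP ->; rewrite mul0r.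
Qed.

(** If [F] sums to 0 on each level set of [blk], it does so on any union of them. *)
Lemma sum_blocks0 (V : zmodType) (n N : nat) (blk : nat -> nat) (F : 'I_n -> V)
    (Q : pred nat) :
  (forall j : 'I_n, (blk j < N)%N) ->
  (forall be, \sum_(j < n | blk j == be) F j = 0) ->
  \sum_(j < n | Q (blk j)) F j = 0.
Proof.
move=> blkN sum0.
rewrite (partition_big (fun j => Ordinal (blkN j)) predT)//= big1// => be _.
have [Qbe|Qbe] := boolP (Q be).
  rewrite -[RHS](sum0 be); apply: eq_bigl => j; rewrite -val_eqE/=.
  by apply: andb_idl => /eqP ->.
rewrite big_pred0// => j; apply/negbTE/negP => /andP[Qj /eqP E].
by move: Qbe; rewrite -E/= Qj.
Qed.

Lemma normc_complex (R : rcfType) (z : R[i]) : (Normc.normc z)%:C = `|z|.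
Proof. by rewrite normc_def; case: z. Qed.

Section GreenSpectrum.
Variables (R : realType) (a b : nat -> R) (n : nat).

Notation A := (map_mx (real_complex R) (green a b n)).

Lemma green_herm : A \is hermsymmx.
Proof.
apply: realsym_hermsym.
  apply/is_hermitianmxP; rewrite expr0 scale1r; apply/matrixP => j k.
  by rewrite !mxE minnC maxnC.
by apply/mxOverP => j k; rewrite mxE complex_real.
Qed.

Lemma green_normal : A \is normalmx.
Proof. exact: hermitian_normalmx green_herm. Qed.

(** The columns of this matrix express the linear conditions
    [\sum_(j in block) x j * a j = 0 = \sum_(j in block) x j * b j]
    for each of the [N] level sets of [blk]. *)
Definition block_moments (N : nat) (blk : nat -> nat) : 'M[R[i]]_(n, N + N) :=
  row_mx (\matrix_(j, be) ((blk j == be)%:R * (a j)%:C))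
         (\matrix_(j, be) ((blk j == be)%:R * (b j)%:C)).

Lemma block_momentsP (N : nat) (blk : nat -> nat) (x : 'rV[R[i]]_n) :
  (forall j : 'I_n, (blk j < N)%N) -> x *m block_moments N blk = 0 ->
  forall be, \sum_(j < n | blk j == be) x 0 j * (a j)%:C = 0 /\
             \sum_(j < n | blk j == be) x 0 j * (b j)%:C = 0.
Proof.
move=> blkN; rewrite mul_mx_row -[0]row_mx0 => /eq_row_mx[ea eb] be.
have [beN|beN] := ltnP be N; last first.
  split; rewrite big_pred0// => j; apply/negbTE/eqP => E;
  by have := blkN j; rewrite E ltnNge beN.
move/rowP/(_ (Ordinal beN)): ea; move/rowP/(_ (Ordinal beN)): eb.
rewrite !mxE => eb ea; split; [rewrite -[RHS]ea|rewrite -[RHS]eb];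
rewrite big_mkcond/=; apply: eq_bigr => j _; rewrite !mxE/=;
by case: eqP; rewrite ?mul1r ?mul0r ?mulr0.
Qed.

(** Off the diagonal blocks the Green matrix is [b j * a k] or [a j * b k], so
    its contribution to [x *m A] vanishes together with the block moments of
    [x]; inside a block, [b] may be replaced by [b - al * a] for the same
    reason.  What remains is block diagonal with Hilbert-Schmidt norms
    controlled by the Gram determinants of the blocks. *)
Lemma green_block_le (N : nat) (blk : nat -> nat) (tau : R) (x : 'rV[R[i]]_n) :
  {homo blk : i j / (i <= j)%N} ->
  (forall j : 'I_n, (blk j < N)%N) ->
  (forall be, gram a b n (fun j => blk j == be) <= tau) ->
  x *m block_moments N blk = 0 ->
  normsq (x *m A) <= (2 * tau)%:C * normsq x.
Proof.
move=> blk_homo blkN gram_le /(block_momentsP blkN) mom.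
pose al be := (\sum_(j < n | blk j == be) a j * b j) /
              (\sum_(j < n | blk j == be) a j ^+ 2).
pose D (j k : nat) :=
  (b (minn j k) - al (blk k) * a (minn j k)) * a (maxn j k).
have xAE (k : 'I_n) : (x *m A) 0 k =
    \sum_(j < n | blk j == blk k) x 0 j * (D j k)%:C.
  have blk_lt (j i : nat) : (blk j < blk i)%N -> (j <= i)%N.
    by move=> ji; rewrite leqNgt; apply/negP => /ltnW/blk_homo; rewrite leqNgt ji.
  have lo : \sum_(j < n | (blk j < blk k)%N) x 0 j * (green a b n j k)%:C = 0.
    transitivity ((a k)%:C *
        \sum_(j < n | (blk j < blk k)%N) x 0 j * (b j)%:C).
      rewrite mulr_sumr; apply: eq_bigr => j /blk_lt jk.
      by rewrite mxE (minn_idPl jk) (maxn_idPr jk) rmorphM/=; ring.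
    rewrite (@sum_blocks0 _ _ N blk _ (fun i => (i < blk k)%N)) ?mulr0// => be.
    exact: (mom be).2.
  have hi : \sum_(j < n | (blk k < blk j)%N) x 0 j * (green a b n j k)%:C = 0.
    transitivity ((b k)%:C *
        \sum_(j < n | (blk k < blk j)%N) x 0 j * (a j)%:C).
      rewrite mulr_sumr; apply: eq_bigr => j /blk_lt jk.
      by rewrite mxE (minn_idPr jk) (maxn_idPl jk) rmorphM/=; ring.
    rewrite (@sum_blocks0 _ _ N blk _ (fun i => (blk k < i)%N)) ?mulr0// => be.
    exact: (mom be).1.
  rewrite mxE (bigID (fun j : 'I_n => blk j == blk k))/= [X in _ + X](_ : _ = 0).
    rewrite addr0; under eq_bigr do rewrite mxE.
    apply/eqP; rewrite -subr_eq0 -sumrB; apply/eqP.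
    transitivity ((al (blk k))%:C * (a k)%:C *
        \sum_(j < n | blk j == blk k) x 0 j * (a j)%:C).
      rewrite mulr_sumr; apply: eq_bigr => j jk.
      rewrite -mulrBr -rmorphB mxE /D -mulrBl subKr !rmorphM.
      by rewrite /minn /maxn; case: ifP => _; ring.
    by rewrite (mom _).1 ?mulr0.
  rewrite (bigID (fun j : 'I_n => (blk j < blk k)%N))/=.
  transitivity (0 + 0 : R[i]); last by rewrite addr0.
  congr (_ + _); [rewrite -[RHS]lo|rewrite -[RHS]hi];
  by apply: eq_big => [j|j _]; rewrite ?mxE//; case: ltngtP.
rewrite /normsq mulr_sumr.
have : \sum_(k < n) `|(x *m A) 0 k| ^+ 2 <= \sum_(k < n) \sum_(j < n | blk j == blk k)
    `|x 0 j| ^+ 2 * (\sum_(i < n | blk i == blk k) (D i k) ^+ 2)%:C.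
  apply: ler_sum => k _; rewrite xAE -mulr_suml rmorph_sum/=.
  apply: (le_trans (sqr_norm_sum_le _ _ _)).
  rewrite ler_wpM2l ?sumr_ge0//.
  apply: ler_sum => j _; rewrite real_normK ?complex_real//.
  by rewrite rmorphXn.
move/le_trans; apply; rewrite (exchange_big_dep predT)//=; apply: ler_sum => j _.
rewrite -mulr_sumr mulrC ler_wpM2r ?exprn_ge0// -rmorph_sum/= lecR.
apply: (@le_trans _ _ (2 * gram a b n (fun i => blk i == blk j))); last first.
  by rewrite ler_pM2l.
have := @sheared_green_hs_le _ a b n (fun i => blk i == blk j) _ erefl.
rewrite -/(al (blk j)) exchange_big/=; apply: le_trans.
rewrite le_eqVlt; apply/orP; left; apply/eqP.
apply: eq_big => [k|k /eqP jk]; first by rewrite eq_sym.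
by rewrite /D -jk.
Qed.

Lemma normsq_green_le (x : 'rV[R[i]]_n) :
  normsq (x *m A) <= ((\sum_(j < n) (a j ^+ 2 + b j ^+ 2)) ^+ 2)%:C * normsq x.
Proof.
apply: (le_trans (normsq_mulmx_le _ _)).
rewrite mulrC ler_wpM2r ?sumr_ge0//.
under eq_bigr do under eq_bigr do
  rewrite mxE real_normK ?complex_real// -rmorphXn/=.
under eq_bigr do rewrite -rmorph_sum/=.
rewrite -rmorph_sum/= lecR expr2 mulr_suml; apply: ler_sum => k _.
rewrite mulr_sumr; apply: ler_sum => j _; rewrite mxE exprMn.
rewrite /minn /maxn; case: ifP => _; [rewrite mulrC|];
apply: ler_pM; rewrite ?sqr_ge0//; by rewrite ?lerDl ?lerDr sqr_ge0.
Qed.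

(** Eigenvalues, with multiplicity, of the real symmetric Green matrix. *)
Definition green_eig (i : 'I_n) : R := complex.Re (spectral_diag A 0 i).

Lemma green_eigE i : spectral_diag A 0 i = (green_eig i)%:C.
Proof.
have /mxOverP/(_ 0 i) := hermitian_spectral_diag_real green_herm.
by rewrite /green_eig; case: (spectral_diag _ _ _) => u v /complex_realP[x [-> ->]].
Qed.

Lemma normc_det_green (r : R) :
  Normc.normc (\det (1%:M + (0 +i* r) *: A)) ^+ 2 =
  \prod_i (1 + r ^+ 2 * green_eig i ^+ 2).
Proof.
apply: (@complexI R); rewrite rmorphXn/= normc_complex.
rewrite det_1_scale_spectral ?green_normal// normr_prod -prodrXl rmorph_prod/=.
apply: eq_bigr => i _; rewrite green_eigE -add_Re2_Im2.
by congr (_%:C); rewrite /=; ring.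
Qed.

(** The [2 * N] moment conditions leave a subspace on which the matrix is
    smaller than [k]. *)
Lemma card_green_eig_ge (N : nat) (blk : nat -> nat) (tau k : R) :
  {homo blk : i j / (i <= j)%N} ->
  (forall j : 'I_n, (blk j < N)%N) ->
  (forall be, gram a b n (fun j => blk j == be) <= tau) ->
  0 <= k -> 2 * tau < k ^+ 2 ->
  (#|[set i | (k <= `|green_eig i|)%R]| <= N + N)%N.
Proof.
move=> blk_homo blkN gram_le k0 ltk.
have := @card_large_eigenvalues _ n (N + N) A (block_moments N blk) k%:C.
rewrite green_normal lecR => /(_ isT k0) H.
apply: leq_trans (H _) => [|x x0 xn0]; last first.
  apply: le_lt_trans (green_block_le _ _ gram_le x0) _ => //.
  by rewrite ltr_pM2r ?normsq_gt0// -rmorphXn ltcR.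
rewrite subset_leq_card//; apply/fintype.subsetP => i; rewrite !inE green_eigE.
by rewrite normc_def/= expr0n addr0 sqrtr_sqr lecR.
Qed.

(** The Hilbert-Schmidt norm is at most the total weight. *)
Lemma green_eig_le (i : 'I_n) :
  `|green_eig i| <= \sum_(j < n) (a j ^+ 2 + b j ^+ 2).
Proof.
set L := \sum_(j < n) _.
have L0 : 0 <= L by apply: sumr_ge0 => j _; rewrite addr_ge0 ?sqr_ge0.
rewrite leNgt; apply/negP => Lk; set k := `|green_eig i| in Lk.
have := @card_large_eigenvalues _ n 0 A 0 k%:C.
rewrite green_normal lecR => /(_ isT (ltW (le_lt_trans L0 Lk))) H.
have /eqP/cards0_eq/setP/(_ i) : #|[set i | (k%:C <= `|spectral_diag A 0 i|)%R]| == 0%N.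
  rewrite -leqn0; apply: H => x _ xn0.
  apply: le_lt_trans (normsq_green_le x) _.
  by rewrite ltr_pM2r ?normsq_gt0// -rmorphXn ltcR ltrXn2r.
rewrite !inE green_eigE normc_def/= expr0n addr0 sqrtr_sqr lecR.
by rewrite lexx.
Qed.

End GreenSpectrum.

(** * Greedy partition into blocks of small Gram determinant *)

Section Gram.
Variables (F : realFieldType) (a b : nat -> F).

Lemma eq_gram n (P Q : pred nat) : (forall j, (j < n)%N -> P j = Q j) ->
  gram a b n P = gram a b n Q.
Proof.
by move=> PQ; rewrite /gram; congr (_ * _ - _ ^+ 2);
  apply: eq_bigl => j; rewrite PQ.
Qed.

Lemma gram_recr n (P : pred nat) : ~~ P n -> gram a b n.+1 P = gram a b n P.
Proof.
by move=> Pn; rewrite /gram !(big_mkcond (fun j : 'I_n.+1 => P j))/=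
  !big_ord_recr/= (negbTE Pn) !addr0 -!big_mkcond.
Qed.

Lemma gram0 n : gram a b n pred0 = 0.
Proof. by rewrite /gram !big_pred0_eq mul0r expr0n subr0. Qed.

Lemma gram1 n : gram a b n.+1 (pred1 n) = 0.
Proof.
rewrite /gram !(big_pred1 (ord_max : 'I_n.+1)) => [|j|j|j]; last 3 first.
- by rewrite /= -val_eqE.
- by rewrite /= -val_eqE.
- by rewrite /= -val_eqE.
by ring.
Qed.

End Gram.

Section Blocks.
Variables (R : realType) (a b : nat -> R) (nu tau : R) (E : nat -> nat -> R).
Hypothesis nu_gt0 : 0 < nu.
Hypothesis tau_gt0 : 0 < tau.
(* [E] majorises the [nu]-th powers of the Gram determinants of intervals and is
   superadditive under concatenation of intervals. *)
Hypothesis E_ge0 : forall m n, (m <= n)%N -> 0 <= E m n.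
Hypothesis E_super : forall m k n, (m <= k)%N -> (k <= n)%N ->
  E m k + E k n <= E m n.
Hypothesis gram_le : forall m n, (m < n)%N ->
  (gram a b n (leq m)) `^ nu <= E m n.

(** Cut [0, n) from the left into intervals, closing the current interval
    [s, k) as soon as adding [k] would make its Gram determinant exceed [tau];
    the index [k] then forms a block of its own.  Blocks [0 .. M.*2 - 1] are
    complete and [M.*2] is the current interval, starting at [s].  Each of the
    [M] overflows costs at least [tau `^ nu] of the superadditive budget [E]. *)
Lemma greedy_blocks n : exists (blk : nat -> nat) (M s : nat),
  [/\ (s <= n)%N, {homo blk : i j / (i <= j)%N},
      (forall j, (s <= j)%N -> blk j = M.*2) /\
      (forall j, (j < s)%N -> (blk j < M.*2)%N),
      forall be, gram a b n (fun j => blk j == be) <= tau &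
      M%:R * tau `^ nu <= E 0%N s].
Proof.
elim: n => [|n [blk [M [s [sn blk_homo [blk_s blk_lt] blk_gram ME]]]]].
  exists (fun=> 0%N), 0%N, 0%N; split=> // [be|].
    by rewrite /gram !big_ord0 mul0r expr0n subr0 ltW.
  by rewrite mul0r E_ge0.
have gramS be : be != M.*2 -> gram a b n.+1 (fun j => blk j == be) <= tau.
  by move=> be2M; rewrite gram_recr ?blk_gram// (blk_s n sn) eq_sym.
have [le_tau|tau_lt] := leP (gram a b n.+1 (leq s)) tau.
  exists blk, M, s; split=> // [|be]; first exact: leqW.
  have [->|/gramS//] := eqVneq be M.*2.
  rewrite (@eq_gram _ _ _ _ _ (leq s))// => j _.
  have [/(blk_s j)->|js] := leqP s j; first by rewrite eqxx.
  by rewrite ltn_eqF// blk_lt.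
pose blk' j := if (j < n)%N then blk j else if j == n then M.*2.+1 else M.+1.*2.
have blk_le j : (blk j <= M.*2)%N.
  by have [/(blk_s j)->//|js] := leqP s j; rewrite ltnW// blk_lt.
exists blk', M.+1, n.+1; split=> //.
- move=> i j ij; rewrite /blk'.
  case: (ltngtP j n) => jn; case: (ltngtP i n) => in_ //=;
  first [exact: blk_homo | by have := blk_le i; lia].
- split=> [j nj|i in1]; rewrite /blk'.
    by rewrite ltnNge (ltnW nj)/= gtn_eqF.
  by have := blk_le i; case: (ltngtP i n) in1 => //=; lia.
- move=> be; have [lebe|] := leqP be M.*2.
    rewrite gram_recr; last by rewrite /blk' ltnn eqxx; apply/eqP; lia.
    by rewrite (@eq_gram _ _ _ _ _ (fun j => blk j == be))// => j jn; rewrite /blk' jn.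
  move=> ltbe; have [->|be1] := eqVneq be M.*2.+1.
    rewrite (@eq_gram _ _ _ _ _ (pred1 n)) ?gram1 ?ltW// => j jn /=.
    rewrite /blk'; case: (ltngtP j n) jn => [jn _|jn|-> _]; [|lia|by rewrite !eqxx].
    by rewrite ltn_eqF// ltnS blk_le.
  rewrite (@eq_gram _ _ _ _ _ pred0) ?gram0 ?ltW// => j jn /=.
  rewrite /blk'; case: (ltngtP j n) jn => [jn _|jn|_ _]; [|lia|by rewrite eq_sym (negbTE be1)].
  by rewrite ltn_eqF// (leq_ltn_trans (blk_le j)).
- apply: le_trans (E_super (leq0n s) (leqW sn)); rewrite -natr1 mulrDl mul1r.
  apply: lerD => //; apply: le_trans (gram_le _); last by rewrite ltnS.
  by rewrite ge0_ler_powR// ?nnegrE ?ltW// (lt_trans tau_gt0).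
Qed.

End Blocks.

(** * From eigenvalue counts to a bound on the determinant *)

(** With blocks of Gram determinant at most [k ^+ 2 / 4] the remaining matrix
    has norm below [k], and there are [2 * M + 1] blocks with
    [M * (k ^+ 2 / 4) `^ nu <= Einf]; finally [4 `^ nu <= 2]. *)
Lemma card_green_eig_le (R : realType) (a b : nat -> R) (n : nat) (nu k Einf : R)
    (E : nat -> nat -> R) :
  0 < nu -> nu <= 2^-1 ->
  (forall m n, (m <= n)%N -> 0 <= E m n) ->
  (forall m k n, (m <= k)%N -> (k <= n)%N -> E m k + E k n <= E m n) ->
  (forall m n, (m < n)%N -> (gram a b n (leq m)) `^ nu <= E m n) ->
  E 0%N n <= Einf -> 0 < k ->
  #|[set i : 'I_n | (k <= `|green_eig a b i|)%R]|%:R <= 2 + 8 * Einf / k `^ (2 * nu).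
Proof.
move=> nu0 nu_half E0 Esup Egram Einf_ge k0.
pose tau := k ^+ 2 / 4.
have tau0 : 0 < tau by rewrite divr_gt0 ?exprn_gt0.
have [blk [M [s [sn blk_homo [blk_s blk_lt] blk_gram ME]]]] :=
  greedy_blocks nu0 tau0 E0 Esup Egram n.
have blkN (j : 'I_n) : (blk j < M.*2.+1)%N.
  by have [/blk_s->|/blk_lt/ltnW] := leqP s j.
have := @card_green_eig_ge _ a b n _ blk tau k blk_homo blkN blk_gram (ltW k0).
have -> : 2 * tau < k ^+ 2 = true.
  by have := exprn_gt0 2 k0; rewrite /tau; lra.
move=> /(_ isT); rewrite -(ler_nat R) => /le_trans; apply.
have -> : (M.*2.+1 + M.*2.+1)%:R = 2 + 4 * M%:R :> R.
  by rewrite -natrM -natrD; congr (_%:R); lia.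
rewrite lerD2l.
have pk : 0 < k `^ (2 * nu) by exact: powR_gt0.
have tauE : k `^ (2 * nu) <= 2 * tau `^ nu.
  have kE : k ^+ 2 = 4 * tau by rewrite /tau; field.
  rewrite powRrM -[2]/(2%:R) powR_mulrn ?(ltW k0)// kE powRM ?(ltW tau0)//.
  rewrite ler_wpM2r ?powR_ge0//.
  have -> : 2 = 4 `^ 2^-1 :> R.
    by rewrite powR12_sqrt// (_ : 4 = 2 ^+ 2) ?sqrtr_sqr ?ger0_norm//; ring.
  by rewrite ler_powR// ler1n.
have EM : M%:R * tau `^ nu <= Einf.
  apply: (le_trans ME); apply: le_trans Einf_ge.
  by apply: le_trans (Esup 0%N s n _ sn); rewrite // lerDl E0.
rewrite ler_pdivlMr//.
apply: (@le_trans _ _ (4 * M%:R * (2 * tau `^ nu))).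
  by rewrite ler_wpM2l.
by lra.
Qed.

(** The values [x i] listed in decreasing order as [y 0 >= y 1 >= ...]: there are
    at least [k + 1] indices with [x i >= y k]. *)
Lemma decreasing_rearrangement (R : realDomainType) (n : nat) (x : 'I_n -> R) :
  exists y : nat -> R,
    (forall (V : nmodType) (G : R -> V), \sum_i G (x i) = \sum_(k < n) G (y k)) /\
    forall k, (k < n)%N ->
      (exists i, y k = x i) /\ (k < #|[set i | (y k <= x i)%R]|)%N.
Proof.
pose s := sort >=%R [seq x i | i <- enum 'I_n].
have ss : size s = n by rewrite size_sort size_map size_enum_ord.
have s_sorted : sorted >=%R s by apply: sort_sorted => u v; exact: le_total.
exists (nth 0 s); split=> [V G|k kn].
  rewrite -(big_mkord predT (fun k => G (nth 0 s k))).
  rewrite -[X in \sum_(0 <= _ < X | _) _]ss -(big_nth 0 predT G) (perm_big _ (permEl (perm_sort _ _)))/=.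
  by rewrite big_map big_enum.
split.
  have : nth 0 s k \in s by rewrite mem_nth ?ss.
  by rewrite mem_sort => /mapP[i _ ->]; exists i.
have -> : #|[set i | (nth 0 s k <= x i)%R]| =
    count (fun u => nth 0 s k <= u) s.
  rewrite (permP (permEl (perm_sort _ _))) count_map cardsE cardE size_filter.
  by rewrite enumT.
rewrite -[s in count _ s](cat_take_drop k.+1) count_cat.
apply: leq_trans (leq_addr _ _).
suff /eqP -> : count (fun u => nth 0 s k <= u) (take k.+1 s) == size (take k.+1 s).
  by rewrite size_takel ?ss.
rewrite -all_count; apply/(all_nthP 0) => j; rewrite size_takel ?ss// => jk.
rewrite nth_take//; apply: (sorted_leq_nth _ _ _ s_sorted) => //.
- by move=> u v w; exact: ge_trans.
- by move=> u; exact: lexx.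
- by rewrite inE ss (leq_ltn_trans _ kn).
- by rewrite inE ss.
Qed.

Lemma ln_prod (R : realType) (I : finType) (x : I -> R) : (forall i, 0 < x i) ->
  ln (\prod_i x i) = \sum_i ln (x i).
Proof.
move=> x0.
suff [] : 0 < \prod_i x i /\ ln (\prod_i x i) = \sum_i ln (x i) by [].
elim/big_ind2: _ => [|u v u' v' [u0 <-] [u'0 <-]|i _]; first by rewrite ln1.
  by rewrite mulr_gt0// lnM.
by split.
Qed.

Section Estimates.
Variable R : realType.

(** Subadditivity of [t |-> t `^ p] for [p <= 1]. *)
Lemma powR_1D_le (p t : R) : 0 < p -> p <= 1 -> 0 <= t ->
  (1 + t) `^ p <= 1 + t `^ p.
Proof.
move=> p0 p1 t0; have t10 : 0 < 1 + t by rewrite ltr_pwDl.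
have sub (u : R) : 0 <= u -> u <= 1 -> u <= u `^ p.
  rewrite le_eqVlt => /predU1P[<- _|u0 u1]; first exact: powR_ge0.
  by apply: ger1_powR; rewrite ?u0.
have h1 : (1 + t)^-1 <= ((1 + t)^-1) `^ p.
  by apply: sub; rewrite ?invr_ge0 ?(ltW t10)// invf_le1// lerDl.
have h2 : t / (1 + t) <= (t / (1 + t)) `^ p.
  by apply: sub; rewrite ?divr_ge0 ?(ltW t10)// ler_pdivrMr// mul1r lerDr.
have e1 : (1 + t)^-1 `^ p = ((1 + t) `^ p)^-1.
  by rewrite -powR_inv1 ?ltW// -powRrM mulN1r powRN.
rewrite powRM ?invr_ge0 ?(ltW t10)// e1 in h2; rewrite e1 in h1.
have e : (1 + t)^-1 + t / (1 + t) = 1 by field; rewrite gt_eqF.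
have := lerD h1 h2; rewrite e -{1}[(_ `^ _)^-1]mul1r -mulrDl.
by rewrite ler_pdivlMr ?powR_gt0// mul1r.
Qed.

Lemma ln_1Dsqr_le_sqrt (w : R) : 0 <= w -> ln (1 + (w ^+ 2) ^+ 2) <= 4 * w.
Proof.
move=> w0; have w2 := sqr_ge0 w; have w3 : 0 <= w * w ^+ 2 by rewrite mulr_ge0.
apply: (@le_trans _ _ (ln ((1 + w) ^+ 4))).
  rewrite ler_ln ?posrE ?exprn_gt0 ?ltr_pwDl ?sqr_ge0//.
  have -> : (1 + w) ^+ 4 =
    1 + (w ^+ 2) ^+ 2 + (4 * w + 6 * w ^+ 2 + 4 * (w * w ^+ 2)) by ring.
  by rewrite lerDl; lra.
rewrite lnXn ?ltr_pwDl// -[leLHS]mulr_natl ler_pM2l//.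
by rewrite le_ln1Dx// (lt_le_trans _ w0) ?ltrN10.
Qed.

Lemma ln_1D_le (w : R) : 0 <= w -> ln (1 + w) <= w.
Proof. by move=> w0; rewrite le_ln1Dx// (lt_le_trans _ w0) ?ltrN10. Qed.

(** The full series sums to [ln (sinh (pi X) / (pi X))]; a linear bound in [X]
    is all that matters. *)
Lemma sum_ln_1Dsqr_le (X : R) (m : nat) : 0 <= X ->
  \sum_(j < m) ln (1 + (X / j.+1%:R) ^+ 2) <= 10 * X.
Proof.
move=> X0; pose S m := \sum_(j < m) ln (1 + (X / j.+1%:R) ^+ 2).
(* Terms with [j + 1 <= X] are estimated by [4 * sqrt (X / (j + 1))], the others
   by [(X / (j + 1)) ^+ 2]; both majorants telescope. *)
have [k [kX Xk]] : exists k : nat, k%:R <= X /\ X < k.+1%:R.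
  by exists (Num.truncn X); apply/andP; exact: truncn_itv.
have S_mono i : S i <= S i.+1.
  by rewrite /S big_ord_recr/= lerDl ln_ge0// lerDl sqr_ge0.
have lo i : S i <= 8 * Num.sqrt X * Num.sqrt i%:R.
  elim: i => [|i IH]; first by rewrite /S big_ord0 sqrtr0 mulr0.
  rewrite /S big_ord_recr/= -/(S i); set u := Num.sqrt i%:R in IH *.
  set v := Num.sqrt i.+1%:R; set x := Num.sqrt X in IH *.
  have v0 : 0 < v by rewrite sqrtr_gt0 ltr0Sn.
  have u0 : 0 <= u by exact: sqrtr_ge0.
  have x0 : 0 <= x by exact: sqrtr_ge0.
  have uE : u ^+ 2 = i%:R by rewrite sqr_sqrtr.
  have vE : v ^+ 2 = i.+1%:R by rewrite sqr_sqrtr.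
  have xE : x ^+ 2 = X by rewrite sqr_sqrtr.
  have -> : X / i.+1%:R = (x / v) ^+ 2 by rewrite expr_div_n vE xE.
  have := @ln_1Dsqr_le_sqrt (x / v) (divr_ge0 x0 (ltW v0)).
  suff : 4 * (x / v) <= 8 * x * (v - u) by lra.
  rewrite (_ : 8 * x * (v - u) = 4 * (x * (2 * (v - u)))); last by ring.
  rewrite ler_pM2l// ler_wpM2l// -[v^-1]mul1r ler_pdivrMr//.
  have uv : u ^+ 2 + 1 = v ^+ 2 by rewrite uE vE -natr1.
  by have := sqr_ge0 (v - u); lra.
have lok : S k <= 8 * X.
  apply: (le_trans (lo k)); rewrite -mulrA ler_pM2l//.
  rewrite -[leRHS]sqr_sqrtr// expr2 ler_wpM2l ?sqrtr_ge0//.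
  by rewrite ler_sqrt.
have hi i : S (k.+1 + i)%N <= 8 * X + X ^+ 2 * (2 / k.+1%:R - (k.+1 + i)%:R^-1).
  have step j : S j.+1 <= S j + X ^+ 2 / j.+1%:R ^+ 2.
    by rewrite /S big_ord_recr/= lerD2l -expr_div_n ln_1D_le ?sqr_ge0.
  elim: i => [|i IH].
    rewrite addn0; apply: (le_trans (step k)); apply: lerD => //.
    rewrite ler_wpM2l ?sqr_ge0//.
    have -> : 2 / k.+1%:R - k.+1%:R^-1 = k.+1%:R^-1 :> R by ring.
    by rewrite -exprVn expr2 ler_piMl ?invr_ge0// invf_le1 ?ler1n ?ltr0Sn.
  rewrite addnS; apply: (le_trans (step _)); apply: (le_trans (lerD IH (lexx _))).
  rewrite -addrA lerD2l -mulrDr ler_wpM2l ?sqr_ge0//.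
  rewrite -addrA lerD2l.
  have : (0 : R) < (k.+1 + i)%:R by rewrite ltr0n addSn.
  rewrite -[in X in _ -> X]natr1; set q := (k.+1 + i)%:R => q0.
  suff : (q + 1)^-1 + (q + 1) ^- 2 <= q^-1 by lra.
  have -> : q^-1 = (q + 1)^-1 + (q + 1)^-1 * q^-1.
    by field; rewrite !gt_eqF// addr_gt0.
  rewrite lerD2l -exprVn expr2 ler_wpM2l ?invr_ge0 ?addr_ge0 ?(ltW q0)//.
  by rewrite lef_pV2 ?posrE ?addr_gt0// lerDl.
have hi10 i : S (k.+1 + i)%N <= 10 * X.
  apply: (le_trans (hi i)).
  have : X ^+ 2 * (2 / k.+1%:R - (k.+1 + i)%:R^-1) <= X * 2.
    rewrite expr2 -mulrA ler_wpM2l//.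
    apply: (@le_trans _ _ (X * (2 / k.+1%:R))).
      by rewrite ler_wpM2l// gerDl oppr_le0 invr_ge0.
    rewrite mulrCA ger_pMr// ler_pdivrMr ?ltr0Sn// mul1r.
    exact: ltW.
  by move=> h; apply: (le_trans (lerD (lexx _) h)); lra.
have [mk|km] := leqP m k.
  apply: (@le_trans _ _ (S k)); last by lra.
  by rewrite -(subnKC mk); elim: (k - m)%N => [|i IH]; rewrite ?addn0// addnS (le_trans IH).
by rewrite -(subnKC km); exact: hi10.
Qed.

End Estimates.

Lemma ln_1Dsqr_le_powR (R : realType) (nu t Y : R) :
  0 < nu -> nu <= 2^-1 -> 0 <= t -> t `^ (2 * nu) <= Y ->
  ln (1 + t ^+ 2) <= (2 * nu)^-1 * ln (1 + Y ^+ 2).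
Proof.
move=> nu0 nu_half t0 tY; have nu20 : 0 < 2 * nu by rewrite mulr_gt0.
have t1 : 0 < 1 + t ^+ 2 by rewrite ltr_pwDl ?sqr_ge0.
have Y0 : 0 <= Y by apply: le_trans tY; exact: powR_ge0.
rewrite mulrC ler_pdivlMr// mulrC -ln_powR.
rewrite ler_ln ?posrE ?powR_gt0 ?ltr_pwDl ?sqr_ge0//.
apply: le_trans (powR_1D_le _ _ _) _; rewrite ?sqr_ge0//; first by lra.
rewrite lerD2l -[t ^+ 2]powR_mulrn// powRAC powR_mulrn ?powR_ge0//.
by rewrite lerXn2r ?nnegrE ?powR_ge0.
Qed.

(** List the moduli of the eigenvalues decreasingly as [y 0 >= y 1 >= ...].
    The count of eigenvalues gives [k - 1 <= 8 * Einf / y k `^ (2 * nu)] for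
    [k >= 2], hence the terms of [\sum_k ln (1 + (r * y k) ^+ 2)] are at most
    [(2 * nu)^-1 * ln (1 + (X / (k - 1)) ^+ 2)] with
    [X = 8 * Einf * r `^ (2 * nu)], while the first two are estimated by means
    of [L]. *)
Lemma ln_det_green_le (R : realType) (a b : nat -> R) (n : nat)
    (nu r L Einf : R) (E : nat -> nat -> R) :
  0 < nu -> nu <= 2^-1 ->
  (forall m n, (m <= n)%N -> 0 <= E m n) ->
  (forall m k n, (m <= k)%N -> (k <= n)%N -> E m k + E k n <= E m n) ->
  (forall m n, (m < n)%N -> (gram a b n (leq m)) `^ nu <= E m n) ->
  E 0%N n <= Einf -> \sum_(j < n) (a j ^+ 2 + b j ^+ 2) <= L -> 0 < r ->
  ln (Normc.normc (\det (1%:M + (0 +i* r) *: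
     map_mx (real_complex R) (green a b n)))) <=
  ln (1 + (r * L) ^+ 2) + 20 * (Einf / nu) * r `^ (2 * nu).
Proof.
move=> nu0 nu_half E0 Esup Egram Einf_ge L_ge r0.
set w := Normc.normc _.
have Einf0 : 0 <= Einf by exact: le_trans (E0 0%N n _) Einf_ge.
have wE : w ^+ 2 = \prod_(i < n) (1 + r ^+ 2 * (green_eig a b i) ^+ 2).
  exact: normc_det_green.
have pos (u : R) : 0 < 1 + r ^+ 2 * u ^+ 2.
  by rewrite -exprMn ltr_pwDl ?sqr_ge0.
have w0 : 0 < w.
  have : 0 < w ^+ 2 by rewrite wE prodr_gt0.
  have : 0 <= w by rewrite -ler0c normc_complex.
  by rewrite le0r => /predU1P[->|//]; rewrite expr0n ltxx.
have [y [ysum ycard]] :=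
  decreasing_rearrangement (fun i : 'I_n => `|green_eig a b i|).
pose X := 8 * Einf * r `^ (2 * nu).
pose T k := if (k < 2)%N then ln (1 + (r * L) ^+ 2) else
  (2 * nu)^-1 * ln (1 + (X / k.-1%:R) ^+ 2).
have T0 k : 0 <= T k.
  rewrite /T; case: ifP => _; first by rewrite ln_ge0// lerDl sqr_ge0.
  by rewrite mulr_ge0 ?invr_ge0 ?mulr_ge0 ?(ltW nu0)// ln_ge0// lerDl sqr_ge0.
have yT k : (k < n)%N -> ln (1 + r ^+ 2 * y k ^+ 2) <= T k.
  move=> kn; have [[i yi] kcard] := ycard k kn.
  have y0 : 0 <= y k by rewrite yi.
  have yL : y k <= L by rewrite yi; exact: le_trans (green_eig_le _ _ _) L_ge.
  rewrite -exprMn /T; case: ltnP => k2.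
    rewrite ler_ln ?posrE ?ltr_pwDl ?sqr_ge0// lerD2l.
    by rewrite lerXn2r ?nnegrE ?mulr_ge0 ?(ltW r0) ?(le_trans y0)// ler_pM2l.
  apply: ln_1Dsqr_le_powR; rewrite ?mulr_ge0 ?(ltW r0)//.
  have [->|yn0] := eqVneq (y k) 0.
    rewrite mulr0 powR0 ?divr_ge0 ?mulr_ge0 ?powR_ge0//.
    by rewrite gt_eqF// mulr_gt0.
  have ypos : 0 < y k by rewrite lt0r yn0.
  have := card_green_eig_le nu0 nu_half E0 Esup Egram Einf_ge ypos.
  move: kcard; rewrite -(ler_nat R) => /le_trans/[apply].
  have kE : k.+1%:R = 2 + k.-1%:R :> R by rewrite -natrD; congr (_%:R); lia.
  rewrite kE lerD2l ler_pdivlMr ?powR_gt0// => le_X.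
  have k0 : (0 : R) < k.-1%:R by rewrite ltr0n; lia.
  rewrite ler_pdivlMr// powRM ?(ltW r0)// /X.
  rewrite [leLHS](_ : _ = k.-1%:R * y k `^ (2 * nu) * r `^ (2 * nu)); last by ring.
  by rewrite ler_wpM2r ?powR_ge0.
have key : ln (w ^+ 2) <=
    2 * ln (1 + (r * L) ^+ 2) + (2 * nu)^-1 * (10 * X).
  rewrite wE ln_prod//.
  rewrite (eq_bigr (fun i : 'I_n => ln (1 + r ^+ 2 * `|green_eig a b i| ^+ 2))); last first.
    by move=> i _; rewrite real_normK ?num_real.
  rewrite (ysum _ (fun u => ln (1 + r ^+ 2 * u ^+ 2))).
  apply: (@le_trans _ _ (\sum_(k < n) T k)).
    by apply: ler_sum => k _; exact: yT.
  apply: (@le_trans _ _ (\sum_(k < n.+2) T k)).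
    by rewrite !big_ord_recr/= -addrA lerDl addr_ge0.
  rewrite 2!big_ord_recl/= addrA /T/= -mulr2n -[X in X + _ <= _]mulr_natl lerD2l.
  rewrite -mulr_sumr ler_wpM2l ?invr_ge0 ?mulr_ge0 ?(ltW nu0)//.
  apply: sum_ln_1Dsqr_le.
  by rewrite /X !mulr_ge0 ?powR_ge0.
rewrite lnXn// -[leLHS]mulr_natl in key.
have e : (2 * nu)^-1 * (10 * X) = 2 * (20 * (Einf / nu) * r `^ (2 * nu)).
  by rewrite /X; field; rewrite gt_eqF.
by rewrite e -mulrDr ler_pM2l in key.
Qed.

Local Open Scope classical_set_scope.
Local Open Scope ring_scope.
Local Open Scope complex_scope.

(** * Absolutely continuous functions with constant derivative almost everywhere *)

Section AbsoluteContinuity.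
Variable R : realType.
Implicit Types f g : R -> R.

Lemma abs_continuousS (a b a' b' : R) f : a <= a' -> b' <= b ->
  abs_continuous a b f -> abs_continuous a' b' f.
Proof.
move=> aa' b'b ac e e0; have [d d0 H] := ac e e0; exists d => // n u v uv.
by apply: H => i; have [h1 [h2 h3]] := uv i; split; [lra|split=> //; lra].
Qed.

Lemma abs_continuousD (a b : R) f g : abs_continuous a b f ->
  abs_continuous a b g -> abs_continuous a b (fun t => f t + g t).
Proof.
move=> acf acg e e0; have e20 : 0 < e / 2 by rewrite divr_gt0.
have [d d0 Hf] := acf _ e20; have [d' d'0 Hg] := acg _ e20.
exists (Num.min d d') => [|n u v uv tr]; first by rewrite lt_min d0.
rewrite lt_min => /andP[/(Hf _ _ _ uv tr) hf /(Hg _ _ _ uv tr) hg].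
rewrite [ltRHS]splitr; apply: le_lt_trans (ltrD hf hg); rewrite -big_split; apply: ler_sum => i _ /=.
by rewrite opprD addrACA ler_normD.
Qed.

Lemma abs_continuousZ (a b k : R) f : abs_continuous a b f ->
  abs_continuous a b (fun t => k * f t).
Proof.
move=> acf e e0; have k0 : 0 < `|k| + 1 by rewrite ltr_wpDl.
have [d d0 H] := acf _ (divr_gt0 e0 k0); exists d => // n u v uv tr sd.
have := H _ _ _ uv tr sd; rewrite ltr_pdivlMr// mulrC; apply: le_lt_trans.
rewrite mulr_sumr; apply: ler_sum => i _.
by rewrite -mulrBr normrM ler_wpM2r// lerDl.
Qed.

Lemma abs_continuous_id (a b : R) : abs_continuous a b id.
Proof.
move=> e e0; exists e => // n u v uv tr; apply: le_lt_trans.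
apply: ler_sum => i _; have [_ [uvi _]] := uv i.
by rewrite ger0_norm ?subr_ge0.
Qed.

Lemma abs_continuous_left (a b e : R) f : a < b -> abs_continuous a b f -> 0 < e ->
  exists2 d : R, 0 < d & forall t, a <= t -> t <= b -> b - t < d ->
    `|f b - f t| < e.
Proof.
move=> ab ac e0; have [d d0 H] := ac e e0; exists d => // t at_ tb btd.
have := H 1%N (fun=> t) (fun=> b); rewrite !big_ord1; apply=> //.
by apply/trivIsetP => i j _ _; rewrite !ord1 eqxx.
Qed.

Section SmallSlope.
Variables (a b e : R) (f : R -> R) (U : set R).
Hypothesis ab : a <= b.

(* [`|f t - f a|] is at most [e * (t - a)] plus the variation of [f] over finitely
   many disjoint intervals contained in [U]. *)
Let controlled (t : R) : Prop := exists (n : nat) (u v : 'I_n -> R),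
  [/\ forall i, a <= u i /\ u i <= v i /\ v i <= t,
      trivIset setT (fun i => `]u i, v i[%classic),
      forall i, `]u i, v i[ `<=` U &
      `|f t - f a| <= e * (t - a) + \sum_(i < n) `|f (v i) - f (u i)|].

Hypothesis local_control : forall c, a <= c -> c <= b ->
  (exists2 d, 0 < d & forall s, `|s - c| < d -> U s) \/
  (exists2 d, 0 < d & forall s, `|s - c| < d -> `|f s - f c| <= e * `|s - c|).

Let controlled_slope (t t' : R) : t <= t' -> `|f t' - f t| <= e * (t' - t) ->
  controlled t -> controlled t'.
Proof.
move=> tt' ft [n [u [v [uv tr uvU fta]]]]; exists n, u, v; split=> // [i|].
  by have [? [? ?]] := uv i; split=> //; split=> //; lra.
have -> : f t' - f a = (f t' - f t) + (f t - f a) by lra.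
apply: (le_trans (ler_normD _ _)); apply: (le_trans (lerD ft fta)).
by rewrite addrA -mulrDr; have -> : t' - t + (t - a) = t' - a by lra.
Qed.

Let controlled_open (t t' : R) : 0 <= e -> a <= t -> t <= t' ->
  `]t, t'[ `<=` U -> controlled t -> controlled t'.
Proof.
move=> e0 at_ tt' ttU [n [u [v [uv tr uvU fta]]]].
pose u' (i : 'I_n.+1) := oapp u t (unlift ord0 i).
pose v' (i : 'I_n.+1) := oapp v t' (unlift ord0 i).
exists n.+1, u', v'; split.
- move=> i; rewrite /u' /v'; case: unliftP => [j|] _ /=; last by [].
  by have [? [? ?]] := uv j; split=> //; split=> //; lra.
- have disj (x : R) j : x \in `]t, t'[ -> x \in `]u j, v j[ -> False.
    by rewrite !in_itv/=; have [_ [_ ?]] := uv j; move=> /andP[? _] /andP[_ ?]; lra.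
  move=> i j _ _; rewrite /u' /v'.
  case: unliftP => [i'|] -> /=; case: unliftP => [j'|] -> //= -[x [/= xi xj]].
  + by congr (lift _ _); apply: tr => //; exists x.
  + by case: (@disj x i').
  + by case: (@disj x j').
- by move=> i; rewrite /u' /v'; case: unliftP => [j|] _ /=.
rewrite big_ord_recl {1}/u' {1}/v' unlift_none/=.
under eq_bigr do rewrite /u' /v' liftK/=.
have -> : f t' - f a = (f t' - f t) + (f t - f a) by lra.
apply: (le_trans (ler_normD _ _)).
have : e * (t - a) <= e * (t' - a) by rewrite ler_wpM2l//; lra.
by move: fta; lra.
Qed.

(** The property spreads from [a] to [b] past every point, by a supremum
    argument. *)
Lemma controlled_end : 0 <= e -> controlled b.
Proof.
move=> e0; pose S := [set t | a <= t <= b /\ controlled t].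
have Sa : S a.
  split; first by rewrite lexx ab.
  exists 0%N, (fun=> a), (fun=> a); split=> [[]//||[]//|].
    by move=> [].
  by rewrite !subrr mulr0 big_ord0 normr0 addr0.
have Sub : ubound S b by move=> t [/andP[]].
have supS : has_sup S by split; [exists a|exists b].
set c := sup S.
have ac : a <= c by apply: ub_le_sup => //; exists b.
have cb : c <= b by apply: ge_sup => //; exists a.
have [d d0 jump] : exists2 d, 0 < d & forall t t', a <= t -> t <= c -> c <= t' ->
    c - t < d -> t' - c < d -> controlled t -> controlled t'.
  have [[d d0 dU]|[d d0 df]] := local_control ac cb; exists d => // t t' at_ tc ct' ctd t'cd.
    apply: controlled_open => //; first lra.
    move=> s; rewrite /= in_itv/= => /andP[ts st'].
    by apply: dU; rewrite ltr_distlC; apply/andP; split; lra.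
  apply: controlled_slope; first lra.
  have -> : f t' - f t = (f t' - f c) - (f t - f c) by lra.
  apply: (le_trans (ler_normB _ _)).
  have h1 := df t' _; have h2 := df t _.
  have -> : e * (t' - t) = e * `|t' - c| + e * `|t - c|.
    by rewrite ger0_norm ?subr_ge0// ler0_norm ?subr_le0//; ring.
  by apply: lerD; [apply: df|apply: df]; rewrite ltr_distlC; apply/andP; split; lra.
have [t [/andP[at_ tb] Qt] ct] := sup_adherent d0 supS; rewrite -/c in ct.
have tc : t <= c by apply: ub_le_sup; [exists b|split=> //; rewrite at_].
pose t' := Num.min b (c + d / 2).
have ct' : c <= t' by rewrite le_min cb/=; lra.
have Qt' : controlled t'.
  apply: jump Qt => //; first by lra.
  have t'd : t' <= c + d / 2 by rewrite ge_min lexx orbT.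
  by lra.
have [bt'|t'b] := leP b t'.
  by have -> : b = t' by apply/eqP; rewrite eq_le bt' ge_min lexx.
have : t' <= c.
  by apply: ub_le_sup; [exists b|split=> //; rewrite (le_trans ac ct') (ltW t'b)].
have : t' = c + d / 2 by move: t'b; rewrite /t' minElt; case: ifP => //; lra.
lra.
Qed.

End SmallSlope.

End AbsoluteContinuity.

Section DerivativeAlmostEverywhere.
Variable R : realType.

Lemma is_derive_slope (f : R -> R) (c k e : R) : is_derive c 1 f k -> 0 < e ->
  exists2 d, 0 < d & forall s, `|s - c| < d ->
    `|f s - f c - k * (s - c)| <= e * `|s - c|.
Proof.
move=> fk e0; have [df dk] := fk.
have : (fun h => h^-1 *: ((f \o shift c) (h *: 1) - f c)) @ 0^' --> k.
  by rewrite -dk; exact: df.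
move=> /cvgrPdist_le/(_ e e0) [d /= d0 H]; exists d => // s sd.
have [->|sc] := eqVneq s c; first by rewrite !subrr mulr0 subrr normr0 mulr0.
have sc0 : s - c != 0 by rewrite subr_eq0.
have := H (s - c); rewrite /ball_/= sub0r normrN => /(_ sd sc0).
rewrite /= /GRing.scale/= mulr1 subrK distrC => le_e.
have -> : f s - f c - k * (s - c) = ((s - c)^-1 * (f s - f c) - k) * (s - c).
  by field.
by rewrite normrM ler_wpM2r.
Qed.

Lemma disjoint_itv_length_le (n : nat) (u v : 'I_n -> R) (U : set R) (d : R) :
  (forall i, u i <= v i) -> trivIset setT (fun i => `]u i, v i[%classic) ->
  (forall i, `]u i, v i[ `<=` U) -> measurable U ->
  (lebesgue_measure U < d%:E)%E -> \sum_(i < n) (v i - u i) < d.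
Proof.
move=> uv tr uvU mU Ud; rewrite -lte_fin; apply: le_lt_trans Ud.
have <- : (\sum_(i < n) lebesgue_measure `]u i, v i[%classic =
    (\sum_(i < n) (v i - u i))%:E)%E.
  rewrite -sumEFin; apply: eq_bigr => i _; rewrite lebesgue_measure_itv/= lte_fin.
  by have := uv i; rewrite le_eqVlt => /predU1P[->|->//]; rewrite ltxx subrr.
have <- : lebesgue_measure (\big[setU/set0]_(i < n) `]u i, v i[%classic) =
    (\sum_(i < n) lebesgue_measure `]u i, v i[%classic)%E.
  exact: measure_bigsetU_ord.
apply: le_measure; rewrite ?inE//.
  by apply: bigsetU_measurable => i _; exact: measurable_itv.
by elim/big_ind: _ => // A B AU BU; rewrite subUset.
Qed.

(** After subtracting [k * t] the derivative is 0 outside a null set.  Cover that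
    set by an open [U] whose measure is below the threshold [d] of absolute
    continuity for [e / 2]: outside [U] the slope is locally at most [e'], and
    disjoint intervals inside [U] contribute at most [e / 2]. *)
Theorem abs_continuous_derive_cst (a b k : R) (f : R -> R) :
  a <= b -> abs_continuous a b f ->
  {ae @lebesgue_measure R, forall t, t \in `]a, b[ -> is_derive t 1 f k} ->
  f b - f a = k * (b - a).
Proof.
move=> ab acf [N [mN N0 exN]].
pose g t := f t + (- k) * t.
have acg : abs_continuous a b g.
  exact/abs_continuousD/abs_continuousZ/abs_continuous_id.
suff : `|g b - g a| <= 0.
  by rewrite normr_le0 subr_eq0 /g => /eqP; lra.
apply/ler_addgt0Pr => e e0; rewrite add0r.
pose e' := e / (2 * (b - a + 1)).
have ba1 : 0 < 2 * (b - a + 1) by lra.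
have e'0 : 0 < e' by rewrite divr_gt0.
have [d d0 acd] := acg _ (divr_gt0 e0 (ltr0n R 2)).
pose D := N `|` [set a] `|` [set b].
have mD : measurable D by apply: measurableU => //; exact: measurableU.
have D0 : lebesgue_measure D = 0%E.
  apply/measure_negligible => //; apply: negligibleU; first apply: negligibleU.
  - by apply/negligibleP.
  - by apply/negligibleP => //; exact: lebesgue_measure_set1.
  - by apply/negligibleP => //; exact: lebesgue_measure_set1.
have [U [oU DU UD]] : exists U : set R, [/\ open U, D `<=` U &
    (lebesgue_measure (U `\` D) < d%:E)%E].
  by apply: lebesgue_regularity_outer => //; rewrite [ltLHS]D0 ltry.
have mU : measurable U by exact: open_measurable.
have Ud : (lebesgue_measure U < d%:E)%E.
  have -> : U = (U `\` D) `|` D by rewrite setUC setDUK.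
  rewrite measureU//; [|exact: measurableD|by rewrite setIC setDIK].
  by rewrite [X in (_ + X)%E]D0 adde0.
have control c : a <= c -> c <= b ->
  (exists2 d, 0 < d & forall s, `|s - c| < d -> U s) \/
  (exists2 d, 0 < d & forall s, `|s - c| < d -> `|g s - g c| <= e' * `|s - c|).
  move=> ac cb; have [Dc|Dc] := pselect (D c).
    left; have /nbhs_ballP[eta eta0 H] := open_nbhs_nbhs (conj oU (DU _ Dc)).
    by exists eta => // s sc; apply: H; rewrite /ball/= distrC.
  right; have dc : is_derive c 1 f k.
    have Nc : ~ N c by move=> Nc; apply: Dc; left; left.
    have : ~ ~ (c \in `]a, b[ -> is_derive c 1 f k) by move=> H; exact/Nc/exN.
    move=> /contrapT; apply; rewrite in_itv/= !lt_neqAle ac cb !andbT.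
    by apply/andP; split; apply/eqP => E; apply: Dc; [left; right|right].
  have [eta eta0 H] := is_derive_slope dc e'0; exists eta => // s sc.
  have -> : g s - g c = f s - f c - k * (s - c) by rewrite /g; ring.
  exact: H.
have [n [u [v [uv tr uvU gba]]]] := controlled_end ab control (ltW e'0).
have sumd : \sum_(i < n) (v i - u i) < d.
  by apply: (disjoint_itv_length_le _ tr uvU) => // i; have [_ []] := uv i.
have := acd _ _ _ uv tr sumd.
have h : e' * (b - a) <= e / 2.
  by rewrite /e' mulrAC ler_pdivrMr//; nra.
by move: gba; lra.
Qed.
End DerivativeAlmostEverywhere.

(** * The fundamental solution at the nodes *)

Section ComplexValued.
Variable R : realType.
Implicit Types F G : R -> R[i].

Lemma abs_continuousC_lin (a b : R) F G (p q : R) :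
  abs_continuousC a b F -> abs_continuousC a b G ->
  abs_continuousC a b (fun t => p%:C * F t + q%:C * G t).
Proof.
move=> [reF imF] [reG imG]; split.
  rewrite (_ : (fun _ => _) =
    (fun t => p * complex.Re (F t) + q * complex.Re (G t))).
    by apply: abs_continuousD; apply: abs_continuousZ.
  by apply/funext => t; case: (F t) => ? ?; case: (G t) => ? ? /=; ring.
rewrite (_ : (fun _ => _) =
    (fun t => p * complex.Im (F t) + q * complex.Im (G t))).
  by apply: abs_continuousD; apply: abs_continuousZ.
by apply/funext => t; case: (F t) => ? ?; case: (G t) => ? ? /=; ring.
Qed.

Lemma is_deriveC_lin F G (t p q : R) (dF dG : R[i]) :
  is_deriveC F t dF -> is_deriveC G t dG ->
  is_deriveC (fun t => p%:C * F t + q%:C * G t) t (p%:C * dF + q%:C * dG).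
Proof.
move=> [reF imF] [reG imG]; split.
  rewrite (_ : (fun _ => _) = (p \*: (fun s => complex.Re (F s))) + (q \*: (fun s => complex.Re (G s)))).
    apply: is_derive_eq; case: dF {imF reF} => ? ?; case: dG {imG reG} => ? ? /=.
    by rewrite /GRing.scale/=; ring.
  apply/funext => s; rewrite -[RHS]/(p * complex.Re (F s) + q * complex.Re (G s)).
  by case: (F s) => ? ?; case: (G s) => ? ? /=; ring.
rewrite (_ : (fun _ => _) = (p \*: (fun s => complex.Im (F s))) + (q \*: (fun s => complex.Im (G s)))).
  apply: is_derive_eq; case: dF {imF reF} => ? ?; case: dG {imG reG} => ? ? /=.
  by rewrite /GRing.scale/=; ring.
apply/funext => s; rewrite -[RHS]/(p * complex.Im (F s) + q * complex.Im (G s)).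
by case: (F s) => ? ?; case: (G s) => ? ? /=; ring.
Qed.

Lemma lebesgue_aeS (P Q : R -> Prop) : (forall t, P t -> Q t) ->
  {ae @lebesgue_measure R, forall t, P t} ->
  {ae @lebesgue_measure R, forall t, Q t}.
Proof. by move=> PQ; apply: negligibleS => t /= nQ /PQ. Qed.

Lemma abs_continuousC_derive_cst (a b : R) (k : R[i]) F :
  a <= b -> abs_continuousC a b F ->
  {ae @lebesgue_measure R, forall t, t \in `]a, b[ -> is_deriveC F t k} ->
  F b = F a + (b - a)%:C * k.
Proof.
move=> ab [reF imF] dF.
have re : complex.Re (F b) - complex.Re (F a) = complex.Re k * (b - a).
  apply: abs_continuous_derive_cst ab reF _.
  by apply: (lebesgue_aeS _ dF) => t H /H[].
have im : complex.Im (F b) - complex.Im (F a) = complex.Im k * (b - a).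
  apply: abs_continuous_derive_cst ab imF _.
  by apply: (lebesgue_aeS _ dF) => t H /H[].
case: (F b) (F a) k re im {dF reF imF} => [xb yb] [xa ya] [p q] /= re im.
apply/eqP; rewrite eq_complex/= !mul0r subr0 addr0.
by apply/andP; split; apply/eqP; lra.
Qed.

End ComplexValued.

Section Solution.
Variables (R : realType) (h : hamburger R).

Lemma nodeS n : node h n.+1 = node h n + len h n.
Proof. by rewrite /node big_nat_recr. Qed.

Lemma node_lt m n : (m < n)%N -> node h m < node h n.
Proof.
elim: n => // n IH; rewrite ltnS leq_eqVlt nodeS => /predU1P[->|/IH].
  by rewrite ltrDl len_gt0.
by move=> /lt_trans; apply; rewrite ltrDl len_gt0.
Qed.

Lemma node_le m n : (m <= n)%N -> node h m <= node h n.
Proof. by rewrite leq_eqVlt => /predU1P[->//|/node_lt/ltW]. Qed.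

Lemma node0 : node h 0 = 0.
Proof. by rewrite /node big_geq. Qed.

Lemma node_le_total n : node h n <= total_length h.
Proof.
have nd : nondecreasing_seq (series (len h)) by move=> m k; exact: node_le.
exact: nondecreasing_cvgn_le nd (@len_summable R h) n.
Qed.

Lemma hamiltonian_node (j : nat) (t : R) : node h j <= t < node h j.+1 ->
  hamiltonian h t = xi (ang h j) *m (xi (ang h j))^T.
Proof.
move=> jt; rewrite /hamiltonian (@xget_unique _ _ _ j)// => i.
rewrite /mkset => it.
move: jt it => /andP[jt tj] /andP[it ti].
have [/node_le ij|/node_le ji|//] := ltngtP i j.
  by have := lt_le_trans ti (le_trans ij jt); rewrite ltxx.
by have := lt_le_trans tj (le_trans ji it); rewrite ltxx.
Qed.

Variables (z : R[i]) (W : R -> 'M[R[i]]_2).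
Hypothesis W_sol :
  is_fundamental_solution (hamiltonian h) (total_length h) z W.

Let y (j : nat) (i : 'I_2) : R[i] :=
  W (node h j) i 0 * (cos (ang h j))%:C + W (node h j) i 1 * (sin (ang h j))%:C.

Lemma sum_ord2 (V : nmodType) (F : 'I_2 -> V) : \sum_k F k = F 0 + F 1.
Proof. by rewrite big_ord_recl big_ord1; congr (_ + F _); exact/val_inj. Qed.

Lemma mulmx_symplJ (A : 'M[R[i]]_2) i :
  ((A *m symplJ R[i]) i 0 = A i 1) * ((A *m symplJ R[i]) i 1 = - A i 0).
Proof.
split; rewrite !mxE sum_ord2 !mxE/=.
  by rewrite !(subr0, sub0r, mulr0, mulr1, add0r, addr0).
by rewrite !(subr0, sub0r, mulrN, mulr0, mulr1, add0r, addr0, oppr0).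
Qed.

Lemma mulmx_xi (A : 'M[R[i]]_2) i k (phi : R) :
  (A *m map_mx (real_complex R) (xi phi *m (xi phi)^T)) i k =
  (A i 0 * (cos phi)%:C + A i 1 * (sin phi)%:C) *
  (if k == 0 then cos phi else sin phi)%:C.
Proof.
rewrite mxE sum_ord2 !mxE !big_ord1 !mxE/= !rmorphM/=.
by rewrite mulrDl !mulrA.
Qed.

Let dWJ j : {ae @lebesgue_measure R, forall t, t \in `]node h j, node h j.+1[ ->
  forall i k, is_deriveC (fun s => (W s *m symplJ R[i]) i k) t
    (z * ((W t i 0 * (cos (ang h j))%:C + W t i 1 * (sin (ang h j))%:C) *
      (if k == 0 then cos (ang h j) else sin (ang h j))%:C))}.
Proof.
case: W_sol => _ _; apply: lebesgue_aeS => t dW; rewrite in_itv/= => /andP[jt tj] i k.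
have := dW _ i k; rewrite mxE (@hamiltonian_node j) ?ltW// mulmx_xi; apply.
rewrite in_itv/= (le_lt_trans _ jt) -?node0 ?node_le//=.
exact: lt_le_trans tj (node_le_total _).
Qed.

Let acW i k a b : 0 <= a -> b <= total_length h ->
  abs_continuousC a b (fun t => W t i k).
Proof.
by case: W_sol => _ /(_ i k)[re im] _ a0 bL; split;
  [exact: abs_continuousS re|exact: abs_continuousS im].
Qed.

(** On a piece the row function [W xi] is constant, as [xi^T J xi = 0]. *)
Let y_const j t i : node h j <= t -> t <= node h j.+1 ->
  W t i 0 * (cos (ang h j))%:C + W t i 1 * (sin (ang h j))%:C = y j i.
Proof.
move=> jt tj; set c := cos _; set s := sin _.
have a0 : 0 <= node h j by rewrite -node0 node_le.
have bL : t <= total_length h := le_trans tj (node_le_total _).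
have := @abs_continuousC_derive_cst _ (node h j) t 0
  (fun t => c%:C * W t i 0 + s%:C * W t i 1) jt.
rewrite mulr0 addr0 /y -/c -/s ![_ * c%:C]mulrC ![_ * s%:C]mulrC; apply.
  by apply: abs_continuousC_lin; exact: acW.
apply: (lebesgue_aeS _ (dWJ j)) => u dW; rewrite in_itv/= => /andP[ju ut].
have uj : u \in `]node h j, node h j.+1[.
  by rewrite in_itv/= ju (lt_le_trans ut).
have := is_deriveC_lin (- c) s (dW uj i 1) (dW uj i 0); rewrite -/c -/s/=.
rewrite (_ : _ + _ = 0); last by rewrite rmorphN/=; ring.
congr is_deriveC; apply/funext => v.
by rewrite !mulmx_symplJ rmorphN/=; ring.
Qed.

(** The transfer step [W (x_(j+1)) = W (x_j) (1 - z l H J)], entry by entry. *)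
Lemma fundamental_solution_node j i :
  W (node h j.+1) i 0 =
    W (node h j) i 0 - z * (len h j)%:C * (sin (ang h j))%:C * y j i /\
  W (node h j.+1) i 1 =
    W (node h j) i 1 + z * (len h j)%:C * (cos (ang h j))%:C * y j i.
Proof.
have jj : node h j <= node h j.+1 by exact: node_le.
have a0 : 0 <= node h j by rewrite -node0 node_le.
have bL := node_le_total j.+1.
have lenE : node h j.+1 - node h j = len h j by rewrite nodeS addrAC subrr add0r.
split.
  rewrite (@abs_continuousC_derive_cst _ (node h j) (node h j.+1)
    (- (z * (sin (ang h j))%:C * y j i)) (fun t => W t i 0))//.
  - by rewrite lenE; ring.
  - exact: acW.
  apply: (lebesgue_aeS _ (dWJ j)) => u dW uj.
  have := is_deriveC_lin (-1) 0 (dW uj i 1) (dW uj i 1).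
  have /andP[/ltW ju /ltW uj'] : node h j < u < node h j.+1 by rewrite in_itv in uj.
  rewrite y_const//= (_ : _ + _ = - (z * (sin (ang h j))%:C * y j i)); last first.
    by rewrite rmorphN/=; ring.
  congr is_deriveC; apply/funext => v.
  by rewrite !mulmx_symplJ rmorphN/=; ring.
rewrite (@abs_continuousC_derive_cst _ (node h j) (node h j.+1)
  (z * (cos (ang h j))%:C * y j i) (fun t => W t i 1))//.
- by rewrite lenE; ring.
- exact: acW.
apply: (lebesgue_aeS _ (dWJ j)) => u dW uj.
have := is_deriveC_lin 1 0 (dW uj i 0) (dW uj i 0).
have /andP[/ltW ju /ltW uj'] : node h j < u < node h j.+1 by rewrite in_itv in uj.
rewrite y_const//= (_ : _ + _ = z * (cos (ang h j))%:C * y j i); last by ring.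
congr is_deriveC; apply/funext => v.
by rewrite !mulmx_symplJ; ring.
Qed.

End Solution.

(** * The Gram matrix of the Hamiltonian *)

Lemma Rintegral_piecewise_cst (R : realType) (x c : nat -> R) (M : R) (f : R -> R)
    (m n : nat) :
  (forall j, x j <= x j.+1) -> (forall t, `|f t| <= M) ->
  (forall j t, x j <= t < x j.+1 -> f t = c j) -> (m <= n)%N ->
  \int[lebesgue_measure]_(t in `[x m, x n]) f t =
  \sum_(m <= j < n) c j * (x j.+1 - x j).
Proof.
move=> x_le fM fc mn.
have x_homo i j : (i <= j)%N -> x i <= x j.
  elim: j => [|j IH]; first by rewrite leqn0 => /eqP->.
  rewrite leq_eqVlt => /predU1P[->//|]; rewrite ltnS => /IH/le_trans; exact.
have split_itv k : (m <= k)%N ->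
    `[x m, x k.+1[%classic = `[x m, x k[ `|` `[x k, x k.+1[.
  by move=> mk; apply: itv_bndbnd_setU; rewrite bnd_simp ?x_homo.
have mfk k : measurable_fun `[x k, x k.+1[ f.
  apply: (eq_measurable_fun (cst (c k))) => // t.
  by rewrite inE/= in_itv/= => /fc.
have mf k : (m <= k)%N -> measurable_fun `[x m, x k[ f.
  elim: k => [|k IH]; first by rewrite leqn0 => /eqP->; rewrite set_itvxx; exact: measurable_fun_set0.
  rewrite leq_eqVlt => /predU1P[->|]; first by rewrite set_itvxx; exact: measurable_fun_set0.
  by rewrite ltnS => mk; rewrite split_itv// measurable_funU//; split; [exact: IH|].
have intf k : (m <= k)%N ->
    (@lebesgue_measure R).-integrable `[x m, x k[ (EFin \o f).
  move=> mk; apply: measurable_bounded_integrable => //; last 2 first.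
  - exact: mf.
  - exists M; split; first exact: num_real.
    by move=> u Mu t _; apply: le_trans (fM t) (ltW Mu).
  by rewrite [ltLHS]lebesgue_measure_itv/=; case: ifP => _; rewrite ?ltry.
rewrite -Rintegral_itv_bndo_bndc; last exact: intf.
elim: n mn => [|n IH].
  by rewrite leqn0 => /eqP->; rewrite set_itvxx Rintegral_set0 big_geq.
rewrite leq_eqVlt => /predU1P[->|].
  by rewrite set_itvxx Rintegral_set0 big_geq.
rewrite ltnS => mn; rewrite big_nat_recr//= split_itv// Rintegral_setU//.
- rewrite IH//; congr (_ + _).
  rewrite (@eq_Rintegral _ _ _ _ _ (cst (c n))); last first.
    by move=> t; rewrite inE/= in_itv/= => /fc.
  rewrite Rintegral_cst// [X in fine X]lebesgue_measure_itv/= lte_fin.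
  by have := x_le n; rewrite le_eqVlt => /predU1P[->|->//]; rewrite ltxx subrr.
- by rewrite -split_itv//; apply: intf; exact: leqW.
- apply/disj_setPS => t [/=]; rewrite !in_itv/= => /andP[_ tn] /andP[nt _].
  by have := lt_le_trans tn nt; rewrite ltxx.
Qed.

Lemma det_mx2 (K : comNzRingType) (A : 'M[K]_2) :
  \det A = A 0 0 * A 1 1 - A 0 1 * A 1 0.
Proof.
have l1 : lift (0 : 'I_2) 0 = 1 by exact/val_inj.
have l0 : lift (1 : 'I_2) 0 = 0 by exact/val_inj.
rewrite (expand_det_row _ 0) sum_ord2 /cofactor !det_mx11 !mxE l1 l0 /=.
by rewrite expr0 expr1 mul1r mulN1r mulrN.
Qed.

Section Weights.
Variables (R : realType) (h : hamburger R).

(** Components of the direction of the [j]-th piece, scaled by the square root of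
    its length, so that the mass of the piece is the Gram matrix of
    [(wcos j, wsin j)]. *)
Definition wcos (j : nat) : R := Num.sqrt (len h j) * cos (ang h j).
Definition wsin (j : nat) : R := Num.sqrt (len h j) * sin (ang h j).

Lemma wcos_sin j : wcos j ^+ 2 + wsin j ^+ 2 = len h j.
Proof.
by rewrite /wcos /wsin !exprMn -mulrDr cos2Dsin2 mulr1 sqr_sqrtr// ltW// len_gt0.
Qed.

Lemma Omega_entry (m n : nat) (i k : 'I_2) : (m <= n)%N ->
  Omega (hamiltonian h) (node h m) (node h n) i k =
  \sum_(j < n | (m <= j)%N)
    (if i == 0 then wcos j else wsin j) * (if k == 0 then wcos j else wsin j).
Proof.
move=> mn; rewrite mxE.
rewrite (@Rintegral_piecewise_cst _ (node h)
  (fun j => (xi (ang h j) *m (xi (ang h j))^T) i k) 1)//.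
- rewrite big_geq_mkord; apply: eq_bigr => j _.
  rewrite nodeS (addrC (node h j)) addrK !mxE big_ord1 !mxE.
  have {1}<- : Num.sqrt (len h j) * Num.sqrt (len h j) = len h j.
    by rewrite -expr2 sqr_sqrtr// ltW// len_gt0.
  by rewrite /wcos /wsin; case: (i == 0); case: (k == 0); ring.
- by move=> j; exact: node_le.
- move=> t; rewrite /hamiltonian !mxE big_ord1 !mxE normrM.
  rewrite -[leRHS]mulr1; apply: ler_pM => //;
  by case: ifP => _; rewrite ler_norml ?cos_geN1 ?cos_le1 ?sin_geN1 ?sin_le1.
- by move=> j t jt; rewrite (hamiltonian_node jt).
Qed.

Lemma det_Omega (m n : nat) : (m <= n)%N ->
  \det (Omega (hamiltonian h) (node h m) (node h n)) = gram wcos wsin n (leq m).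
Proof.
move=> mn; rewrite det_mx2 !Omega_entry//= /gram expr2.
under [X in _ - _ * X]eq_bigr do rewrite mulrC.
by under [X in X * _ - _]eq_bigr do rewrite -expr2;
  under [X in _ * X - _]eq_bigr do rewrite -expr2.
Qed.

End Weights.

(** * The growth estimate *)

Lemma sin_eq0_int (R : realType) (x : R) : sin x = 0 ->
  exists k : int, x = k%:~R * pi.
Proof.
move=> sx0; have sin_nat (n : nat) : sin (n%:R * pi) = 0 :> R.
  elim: n => [|n IH]; first by rewrite mul0r sin0.
  by rewrite -natr1 mulrDl mul1r sinDpi IH oppr0.
have sin_int (k : int) : sin (k%:~R * pi) = 0 :> R.
  case: k => n; first exact: sin_nat.
  by rewrite NegzE mulrNz mulNr sinN sin_nat oppr0.
pose k := Num.floor (x / pi); exists k.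
have pi0 : 0 < pi :> R := pi_gt0 R.
have /andP[kx xk] : k%:~R <= x / pi < (k + 1)%:~R by exact: floor_itv.
rewrite ler_pdivlMr// in kx; rewrite ltr_pdivrMr// in xk.
rewrite intrD mulrDl mul1r in xk.
apply/eqP; rewrite -subr_eq0; apply/negPn/negP => xk0.
have : 0 < sin (x - k%:~R * pi).
  apply: sin_gt0_pi; rewrite lt_neqAle eq_sym xk0 subr_ge0 kx/=.
  by rewrite ltrBlDl.
by rewrite sinB sx0 sin_int mul0r mulr0 subrr ltxx.
Qed.

Section Domination.
Variable R : realType.

Lemma powR_dominates (s p A B : R) : s < p -> 0 < A ->
  \forall r \near +oo, B * r `^ s <= A * r `^ p.
Proof.
move=> sp A0; pose M := `|B| / A; have ps0 : 0 < p - s by rewrite subr_gt0.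
exists (M `^ (p - s)^-1); split=> [|r Mr]; first exact: num_real.
have M0 : 0 <= M by rewrite divr_ge0// ltW.
have r0 : 0 < r by apply: le_lt_trans Mr; exact: powR_ge0.
have Mle : M <= r `^ (p - s).
  rewrite -[M]powRr1// -(mulVf (lt0r_neq0 ps0)) powRrM.
  by rewrite ge0_ler_powR ?nnegrE ?powR_ge0// ltW.
have -> : r `^ p = r `^ (p - s) * r `^ s.
  by rewrite -powRD ?subrK// (gt_eqF r0) implybT.
rewrite mulrA ler_wpM2r ?powR_ge0//; apply: (le_trans (ler_norm B)).
by rewrite mulrC -ler_pdivrMr.
Qed.

Lemma ln_1Dsqr_dominated (p A L : R) : 0 < p -> 0 < A ->
  \forall r \near +oo, ln (1 + (r * L) ^+ 2) <= A * r `^ p.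
Proof.
move=> p0 A0; have p20 : 0 < p / 2 by rewrite divr_gt0.
have pp : p / 2 < p by lra.
near=> r.
have r1 : 1 <= r by near: r; apply: nbhs_pinfty_ge; exact: num_real.
have r0 : 0 < r by lra.
have : (4 / p + L ^+ 2) * r `^ (p / 2) <= A * r `^ p.
  by near: r; exact: powR_dominates.
apply: le_trans; set q := r `^ (p / 2).
have q1 : 1 <= q by rewrite -[leLHS](powRr0 r) ler_powR// ltW.
apply: (@le_trans _ _ (ln (r ^+ 2 * (1 + L ^+ 2)))).
  rewrite ler_ln ?posrE ?mulr_gt0 ?exprn_gt0 ?ltr_pwDl ?sqr_ge0//.
  rewrite mulrDr mulr1 exprMn lerD2r -(expr1n _ 2).
  by rewrite lerXn2r ?nnegrE// ltW.
rewrite lnM ?posrE ?exprn_gt0 ?ltr_pwDl ?sqr_ge0// lnXn// mulrDl.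
apply: lerD.
  have lnq : ln q <= q by apply/ltW/ln_sublinear; lra.
  rewrite ln_powR in lnq.
  have -> : ln r *+ 2 = 4 / p * (p / 2 * ln r).
    by rewrite -mulr_natl; field; rewrite gt_eqF.
  by rewrite ler_wpM2l// divr_ge0 ?ltW.
apply: (le_trans (ln_1D_le (sqr_ge0 L))).
by rewrite ler_peMr ?sqr_ge0.
Unshelve. all: by end_near. Qed.

End Domination.

(** [x `^ g * y `^ d] is superadditive when [g + d = 1]. *)
Lemma hoelder2_powR (R : realType) (g d x1 x2 y1 y2 : R) :
  0 < g -> 0 < d -> g + d = 1 -> 0 <= x1 -> 0 <= x2 -> 0 <= y1 -> 0 <= y2 ->
  x1 `^ g * y1 `^ d + x2 `^ g * y2 `^ d <= (x1 + x2) `^ g * (y1 + y2) `^ d.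
Proof.
move=> g0 d0 gd x10 x20 y10 y20.
have gV : g^-1 > 0 by rewrite invr_gt0.
have dV : d^-1 > 0 by rewrite invr_gt0.
have := hoelder2 (powR_ge0 x1 g) (powR_ge0 x2 g) (powR_ge0 y1 d) (powR_ge0 y2 d)
  gV dV.
rewrite !invrK -!powRrM !mulfV ?gt_eqF// !powRr1//; exact.
Qed.

Section Bounds.
Variables (R : realType) (h : hamburger R) (r : R) (W : R -> 'M[R[i]]_2).
Hypothesis W_sol :
  is_fundamental_solution (hamiltonian h) (total_length h) (0 +i* r) W.

(** The recursion of [det_green] with [a], [b] the weighted components: the
    products [wcos * wsin] etc. produce the lengths through
    [sqrt l * sqrt l = l]. *)
Lemma w22_node n : W (node h n) 1 1 =
  \det (1%:M + (0 +i* r) *: map_mx (real_complex R) (green (wcos h) (wsin h) n)).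
Proof.
have W0 : W 0 = 1%:M by case: W_sol.
pose a j := (wcos h j)%:C; pose b j := (wsin h j)%:C.
have -> : map_mx (real_complex R) (green (wcos h) (wsin h) n) = green a b n.
  by apply/matrixP => j k; rewrite !mxE rmorphM.
have lenE j : (len h j)%:C = (Num.sqrt (len h j))%:C * (Num.sqrt (len h j))%:C.
  by rewrite -rmorphM/= -expr2 sqr_sqrtr// ltW// len_gt0.
apply: (@det_green _ a b (fun j => W (node h j) 1 0) (fun j => W (node h j) 1 1)).
- by rewrite node0 W0 mxE.
- by rewrite node0 W0 mxE.
- move=> j; rewrite (fundamental_solution_node W_sol j 1).1.
  by rewrite lenE /a /b /wcos /wsin !rmorphM/=; ring.
- move=> j; rewrite (fundamental_solution_node W_sol j 1).2.
  by rewrite lenE /a /b /wcos /wsin !rmorphM/=; ring.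
Qed.

Lemma cvg_node_total : node h @ \oo --> total_length h.
Proof. exact: (@len_summable R h). Qed.

Lemma cvg_node_AC (f : R -> R) : abs_continuous 0 (total_length h) f ->
  f (node h n) @[n --> \oo] --> f (total_length h).
Proof.
move=> ac; apply/cvgrPdist_lt => e e0.
have L0 : 0 < total_length h.
  by apply: lt_le_trans (node_le_total h 1); rewrite -(node0 h) node_lt.
have [d d0 H] := abs_continuous_left L0 ac e0.
have /cvgrPdist_lt/(_ d d0) := cvg_node_total.
apply: filterS => n nd; apply: H.
- by rewrite -(node0 h) node_le.
- exact: node_le_total.
- by apply: le_lt_trans nd; exact: ler_norm.
Qed.

Lemma ln_w22_total_le (B : R) : 0 <= B ->
  (forall n, ln (Normc.normc (W (node h n) 1 1)) <= B) ->
  ln (Normc.normc (W (total_length h) 1 1)) <= B.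
Proof.
move=> B0 HB.
have normc_sqr (z : R[i]) :
    Normc.normc z ^+ 2 = complex.Re z ^+ 2 + complex.Im z ^+ 2.
  by case: z => x y; rewrite /= sqr_sqrtr// addr_ge0 ?sqr_ge0.
have normc_ge0 (z : R[i]) : 0 <= Normc.normc z.
  by rewrite -ler0c normc_complex.
have wn n : complex.Re (W (node h n) 1 1) ^+ 2 +
    complex.Im (W (node h n) 1 1) ^+ 2 <= expR B ^+ 2.
  rewrite -normc_sqr lerXn2r ?nnegrE ?expR_ge0//.
  have := normc_ge0 (W (node h n) 1 1).
  rewrite le0r => /predU1P[->|w0]; first exact: expR_ge0.
  by rewrite -[leLHS]lnK ?posrE// ler_expR.
have wL : Normc.normc (W (total_length h) 1 1) ^+ 2 <= expR B ^+ 2.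
  rewrite normc_sqr.
  have [_ /(_ 1 1)[reW imW] _] := W_sol.
  have cre := cvg_node_AC reW; have cim := cvg_node_AC imW.
  apply: (cvgr_to_le (cvgD (cvgM cre cre) (cvgM cim cim))).
  by near=> n; exact: (wn n).
have := normc_ge0 (W (total_length h) 1 1).
rewrite le0r => /predU1P[->|w0]; first by rewrite ln0.
rewrite -[leRHS](expRK B) ler_ln ?posrE ?expR_gt0//.
by rewrite -(@ler_pXn2r _ 2) ?nnegrE ?expR_ge0 ?(ltW w0).
Unshelve. all: by end_near. Qed.

Lemma sum_wcos_sin n : \sum_(j < n) (wcos h j ^+ 2 + wsin h j ^+ 2) = node h n.
Proof.
by rewrite /node big_mkord; apply: eq_bigr => j _; rewrite wcos_sin.
Qed.

Lemma ln_w22_le (nu Einf : R) (E : nat -> nat -> R) :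
  0 < nu -> nu <= 2^-1 ->
  (forall m n, (m <= n)%N -> 0 <= E m n) ->
  (forall m k n, (m <= k)%N -> (k <= n)%N -> E m k + E k n <= E m n) ->
  (forall m n, (m < n)%N ->
     (\det (Omega (hamiltonian h) (node h m) (node h n))) `^ nu <= E m n) ->
  (forall n, E 0%N n <= Einf) -> 0 < r ->
  ln (Normc.normc (W (total_length h) 1 1)) <=
  ln (1 + (r * total_length h) ^+ 2) + 20 * (Einf / nu) * r `^ (2 * nu).
Proof.
move=> nu0 nu_half E0 Esup Edet Einf_ge r0; apply: ln_w22_total_le.
  have Einf0 : 0 <= Einf by exact: le_trans (E0 0%N 0%N _) (Einf_ge 0%N).
  rewrite addr_ge0 ?ln_ge0 ?lerDl ?sqr_ge0//.
  by rewrite !mulr_ge0 ?powR_ge0// invr_ge0 ltW.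
move=> n; rewrite w22_node; apply: (@ln_det_green_le _ _ _ _ _ _ _ _ E) => //.
  by move=> m k mk; rewrite -det_Omega ?Edet// ltnW.
by rewrite sum_wcos_sin node_le_total.
Qed.

End Bounds.

Section Geometry.
Variables (R : realType) (h : hamburger R).

Lemma gram_ge0 n (P : pred nat) : 0 <= gram (wcos h) (wsin h) n P.
Proof. by rewrite subr_ge0 sqr_sum_le// => i; exact: num_real. Qed.

Lemma sqrt_det_Omega_le (m n : nat) : (m <= n)%N ->
  (\det (Omega (hamiltonian h) (node h m) (node h n))) `^ 2^-1 <=
  node h n - node h m.
Proof.
move=> mn; rewrite det_Omega//.
have lenE : node h n - node h m = \sum_(j < n | (m <= j)%N) len h j.
  by rewrite /node (big_cat_nat (n := m))//= addrAC subrr add0r big_geq_mkord.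
have l0 : 0 <= node h n - node h m by rewrite subr_ge0 node_le.
have le : gram (wcos h) (wsin h) n (leq m) <= (node h n - node h m) ^+ 2.
  rewrite /gram; apply: (@le_trans _ _ ((\sum_(j < n | (m <= j)%N) wcos h j ^+ 2) *
      (\sum_(j < n | (m <= j)%N) wsin h j ^+ 2))).
    by rewrite gerBl sqr_ge0.
  rewrite expr2 lenE; apply: ler_pM.
  - by apply: sumr_ge0 => j _; exact: sqr_ge0.
  - by apply: sumr_ge0 => j _; exact: sqr_ge0.
  - by apply: ler_sum => j _; rewrite -wcos_sin lerDl sqr_ge0.
  - by apply: ler_sum => j _; rewrite -wcos_sin lerDr sqr_ge0.
apply: (@le_trans _ _ (((node h n - node h m) ^+ 2) `^ 2^-1)).
  by rewrite ge0_ler_powR ?nnegrE ?gram_ge0 ?sqr_ge0.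
by rewrite powR12_sqrt ?sqr_ge0// sqrtr_sqr ger0_norm.
Qed.

(** The determinant is [l_0 l_1 sin (phi_1 - phi_0) ^ 2]. *)
Lemma det_Omega_gt0 :
  0 < \det (Omega (hamiltonian h) (node h 0) (node h 2)).
Proof.
rewrite det_Omega// /gram !(big_mkcond (fun j : 'I_2 => leq 0 j))/=.
rewrite !big_ord_recl !big_ord0/= !addr0.
set a0 := wcos h 0; set a1 := wcos h _; set b0 := wsin h 0; set b1 := wsin h _.
have -> : (a0 ^+ 2 + a1 ^+ 2) * (b0 ^+ 2 + b1 ^+ 2) - (a0 * b0 + a1 * b1) ^+ 2 =
  (a0 * b1 - a1 * b0) ^+ 2 by ring.
have -> : a0 * b1 - a1 * b0 =
    Num.sqrt (len h 0) * Num.sqrt (len h 1) * sin (ang h 1 - ang h 0).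
  by rewrite sinB /a0 /a1 /b0 /b1 /wcos /wsin; ring.
rewrite lt0r sqr_ge0 andbT sqrf_eq0 !mulf_neq0//.
- by rewrite gt_eqF// sqrtr_gt0 len_gt0.
- by rewrite gt_eqF// sqrtr_gt0 len_gt0.
apply/eqP => /sin_eq0_int[k kE].
by have := ang_sep h 0 k; rewrite kE eqxx.
Qed.

End Geometry.

Theorem theorem4p1 (R : realType) :
  exists2 c : R, 0 < c &
  forall (h : hamburger R) (W : R[i] -> R -> 'M[R[i]]_2),
  (forall z : R[i],
    is_fundamental_solution (hamiltonian h) (total_length h) z (W z)) ->
  forall (f g : nat -> R) (nu K gamma delta : R),
  (forall n, 0 < f n) -> (forall n, 0 < g n) ->
  nondecreasing_seq f -> nondecreasing_seq g ->
  bounded_fun f -> bounded_fun g ->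
  0 < nu -> 0 < K -> 0 < gamma -> 0 < delta -> gamma + delta = 1 ->
  (forall m n : nat, (m < n)%N ->
    (\det (Omega (hamiltonian h) (node h m) (node h n))) `^ nu
      <= K * (f n - f m) `^ gamma * (g n - g m) `^ delta) ->
  \forall r \near +oo,
    ln (Normc.normc (W (0 +i* r) (total_length h) 1 1))
      <= c * (K / nu) * r `^ (2 * nu)
         * (limn f - f 0%N) `^ gamma * (limn g - g 0%N) `^ delta.
Proof.
exists 21; first by [].
move=> h W W_sol f g nu K gamma delta _ _ fnd gnd fbd gbd nu0 K0 ga0 de0 gade Edet.
have bounded_le_lim (u : nat -> R) : nondecreasing_seq u -> bounded_fun u ->
    forall n, u n <= limn u.
  move=> und ubd; apply: nondecreasing_cvgn_le => //.
  apply: nondecreasing_is_cvgn => //.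
  have [M [_ HM]] := ubd; exists (M + 1) => _ [n _ <-].
  by apply: le_trans (ler_norm _) _; apply: HM; rewrite ?ltrDl.
have flim := bounded_le_lim f fnd fbd; have glim := bounded_le_lim g gnd gbd.
(* The budget of the greedy partition, superadditive by Hoelder's inequality. *)
pose E m n := K * (f n - f m) `^ gamma * (g n - g m) `^ delta.
pose Einf := K * (limn f - f 0%N) `^ gamma * (limn g - g 0%N) `^ delta.
have E0 m n : (m <= n)%N -> 0 <= E m n.
  by move=> _; rewrite !mulr_ge0 ?powR_ge0// ltW.
have Esup m k n : (m <= k)%N -> (k <= n)%N -> E m k + E k n <= E m n.
  move=> mk kn; rewrite /E -!mulrA -mulrDr ler_pM2l//.
  have -> : f n - f m = (f k - f m) + (f n - f k) by ring.
  have -> : g n - g m = (g k - g m) + (g n - g k) by ring.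
  by apply: hoelder2_powR; rewrite // subr_ge0 ?fnd ?gnd.
have E_le n : E 0%N n <= Einf.
  rewrite /E /Einf -!mulrA ler_pM2l// ler_pM ?powR_ge0//.
    by rewrite ge0_ler_powR ?nnegrE ?subr_ge0 ?fnd ?(ltW ga0)// lerD2r.
  by rewrite ge0_ler_powR ?nnegrE ?subr_ge0 ?gnd ?(ltW de0)// lerD2r.
(* Positivity of [Einf] is what lets [r ^ (2 nu)] absorb the logarithmic term. *)
have Einf0 : 0 < Einf.
  apply: lt_le_trans (E_le 2%N); apply: lt_le_trans (Edet 0%N 2%N _) => //.
  by rewrite powR_gt0// det_Omega_gt0.
have En0 : 0 < Einf / nu by rewrite divr_gt0.
have En20 : 0 < Einf / nu / 2 by rewrite divr_gt0.
set L := total_length h.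
suff : \forall r \near +oo, ln (Normc.normc (W (0 +i* r) L 1 1)) <=
    21 * (Einf / nu) * r `^ (2 * nu).
  apply: filterS => r /le_trans; apply.
  by rewrite le_eqVlt; apply/orP; left; apply/eqP; rewrite /Einf; ring.
have nu20 : 0 < 2 * nu by rewrite mulr_gt0.
have [nu_half|nu_half] := leP nu 2^-1; near=> r.
  have r0 : 0 < r by near: r; apply: nbhs_pinfty_gt; exact: num_real.
  have Hr : ln (1 + (r * L) ^+ 2) <= Einf / nu * r `^ (2 * nu).
    by near: r; exact: (ln_1Dsqr_dominated L nu20 En0).
  have := ln_w22_le (W_sol _) nu0 nu_half E0 Esup Edet E_le r0.
  by rewrite -/L; lra.
(* For [nu > 1/2] the crude bound [det Omega <= (x_n - x_m)^2] already gives
   growth of exponential type, which is dominated by [r ^ (2 nu)]. *)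
have r0 : 0 < r by near: r; apply: nbhs_pinfty_gt; exact: num_real.
have Hr : ln (1 + (r * L) ^+ 2) <= Einf / nu / 2 * r `^ (2 * nu).
  by near: r; exact: (ln_1Dsqr_dominated L nu20 En20).
have Hr1 : 20 * (L / 2^-1) * r `^ (2 * 2^-1) <= Einf / nu / 2 * r `^ (2 * nu).
  by near: r; apply: powR_dominates => //; lra.
have half0 : (0 : R) < 2^-1 by rewrite invr_gt0.
have := @ln_w22_le R h r (W (0 +i* r)) (W_sol _) 2^-1 L
  (fun m n => node h n - node h m) half0 (lexx _).
have : 0 <= Einf / nu * r `^ (2 * nu) by rewrite mulr_ge0 ?powR_ge0// ltW.
move=> pos H; apply: (le_trans (H _ _ _ _ r0)).
- by move=> m n mn; rewrite subr_ge0 node_le.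
- by move=> m k n _ _; lra.
- by move=> m n mn; apply: sqrt_det_Omega_le; exact: ltnW.
- by move=> n; rewrite node0 subr0 node_le_total.
by rewrite -/L; lra.
Unshelve. all: by end_near. Qed.
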